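(* For any integers $r\ge k\ge1$, $h\ge1$, any vector $\vec b=(b_i)_{i\in[k]}$ of positive integers and any $\epsilon>0$, there is a constant $c=c(r,k,h,\vec b,\epsilon)>0$ with the following property. Let $G$ be a $k$-bounded $\vec b$-colored $\mathfrak r$-partite graph on $\Omega$ (for arbitrary finite probability spaces $\Omega_i$), and let $F$ be an $h$-vertex $k$-uniform $(b_k-1)$-colored $\mathfrak r$-partite graph whose visible index-$I$ colors are injectively identified with colors in $C_I(G)$ for every $I$ with $|I|=k$. Then at least one of the following holds: (i) there exists a $k$-bounded $\vec b$-colored $\mathfrak r$-partite graph $G'$ on $\Omega$ such that $\mathbb P_{{\bf e}\in\Omega_I}[G'({\bf e})\ne G({\bf e})]\le\epsilon$ for every $I\subseteq\mathfrak r$ with $|I|=k$, and $\mathbb P_{\phi\in\Phi(h)}[G'(\phi(e))=F(e)\ \forall e\in\mathbb V(F)]=0$; (ii) $\mathbb P_{\phi\in\Phi(h)}[G(\phi(e))=F(e)\ \forall e\in\mathbb V(F)]\ge c$. Here $\phi\in\Phi(h)$ is a random partitionwise map on $V(F)$.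
   Context: Fix a finite index set $\mathfrak r$ with $|\mathfrak r|=r$ and, for each $i\in\mathfrak r$, a nonempty finite probability space $\Omega_i$; $\Omega=(\Omega_i)_{i\in\mathfrak r}$; $[a]=\{1,\dots,a\}$. A $k$-bounded $(b_i)_{i\in[k]}$-colored $\mathfrak r$-partite graph $H$ has disjoint finite vertex sets $V_i(H)$, $i\in\mathfrak r$; $V_J(H)$ is the set of sets consisting of exactly one vertex from each $V_j(H)$, $j\in J$; for each $I\subseteq\mathfrak r$ with $1\le|I|\le k$ there is a color set $C_I(H)$ of exactly $b_{|I|}$ colors and a coloring $V_I(H)\to C_I(H)$, $e\mapsto H(e)$. A graph on $\Omega$ has $V_i=\Omega_i$, and $\Omega_I:=V_I$; random ${\bf e}\in\Omega_I$ has independent vertices distributed by the measures of the $\Omega_i$. A $k$-uniform $b$-colored graph is a $k$-bounded $(1,\dots,1,b)$-colored graph in which, for $|I|<k$, the unique color is called invisible, and for each $I$ with $|I|=k$ at most one color of $C_I$ is designated invisible. $\mathbb V(F)$ is the set of visible edges (edges whose color is not invisible; all of size $k$). $F$ is $h$-vertex if $|V_i(F)|=h$ for every $i$. $\Phi(h)$ is the set of maps $\phi$ on $V(F)=\dot\bigcup_iV_i(F)$ with $\phi(V_i(F))\subseteq\Omega_i$; a random $\phi$ maps each vertex independently according to the measure of $\Omega_i$; for $e\in V_I(F)$, $\phi(e)\in\Omega_I$. *)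

(* Defs.v *)
From HB Require Import structures.
From mathcomp Require Import all_boot all_order all_algebra.
From Stdlib Require Import Rdefinitions.
From mathcomp Require Import Rstruct.

Set Implicit Arguments.
Unset Strict Implicit.
Unset Printing Implicit Defensive.

Import Order.TTheory GRing.Theory Num.Theory.
Local Open Scope ring_scope.

(* The index set frak r is 'I_r. A point of Omega_{[r]} (one vertex in every
   part) is a dependent finite function. An edge of V_I is encoded by any full
   tuple; colorings of V_I are required to depend only on the I-coordinates. *)
Definition vtuple (r : nat) (T : 'I_r -> finType) := {dffun forall i : 'I_r, T i}.

Definition is_prob_space (T : finType) (mu : T -> R) : Prop :=
  (forall x, 0 <= mu x) /\ \sum_(x : T) mu x = 1.

Definition bounded_colored_graph (r k : nat) (b : nat -> nat)
    (T : 'I_r -> finType) (G : {set 'I_r} -> vtuple T -> nat) : Prop :=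
  forall I : {set 'I_r}, (0 < #|I| <= k)%nat ->
    (forall x y : vtuple T, (forall i, i \in I -> x i = y i) -> G I x = G I y)
    /\ (forall x, (G I x < b #|I|)%nat).

(* h-vertex k-uniform nc-colored r-partite graph F: V_i(F) = 'I_h; an edge of
   V_I(F) is encoded by u : 'I_r -> 'I_h (only the I-coordinates matter);
   for |I| = k the coloring Fcol I takes values in {0,..,nc-1}, and inv I is
   the (optional) invisible color of C_I(F). Levels |I| < k carry a single
   invisible color and are not represented. *)
Definition uniform_colored_graph (r k h nc : nat)
    (Fcol : {set 'I_r} -> {ffun 'I_r -> 'I_h} -> nat)
    (inv : {set 'I_r} -> option nat) : Prop :=
  forall I : {set 'I_r}, #|I| = k ->
    (forall u v : {ffun 'I_r -> 'I_h}, (forall i, i \in I -> u i = v i) ->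
        Fcol I u = Fcol I v)
    /\ (forall u, (Fcol I u < nc)%nat)
    /\ (forall c, inv I = Some c -> (c < nc)%nat).

Definition color_ident (r k : nat) (b : nat -> nat) (nc : nat)
    (inv : {set 'I_r} -> option nat) (iota : {set 'I_r} -> nat -> nat) : Prop :=
  forall I : {set 'I_r}, #|I| = k ->
    (forall c, (c < nc)%nat -> Some c != inv I -> (iota I c < b k)%nat) /\
    (forall c c', (c < nc)%nat -> (c' < nc)%nat -> Some c != inv I ->
        Some c' != inv I -> iota I c = iota I c' -> c = c').

Definition edge_weight (r : nat) (T : 'I_r -> finType)
    (mu : forall i, T i -> R) (x : vtuple T) : R :=
  \prod_(i : 'I_r) mu i (x i).

Definition prob_diff (r : nat) (T : 'I_r -> finType) (mu : forall i, T i -> R)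
    (G G' : {set 'I_r} -> vtuple T -> nat) (I : {set 'I_r}) : R :=
  \sum_(x : vtuple T | G' I x != G I x) edge_weight mu x.

Definition pmap (r h : nat) (T : 'I_r -> finType) :=
  {dffun forall i : 'I_r, {ffun 'I_h -> T i}}.

Definition phimap (r h : nat) (T : 'I_r -> finType) (phi : pmap h T)
    (u : {ffun 'I_r -> 'I_h}) : vtuple T :=
  @finfun 'I_r (fun i => T i) (fun i => phi i (u i)).

Definition map_weight (r h : nat) (T : 'I_r -> finType)
    (mu : forall i, T i -> R) (phi : pmap h T) : R :=
  \prod_(i : 'I_r) \prod_(j : 'I_h) mu i (phi i j).

Definition hom_event (r k h : nat) (T : 'I_r -> finType)
    (Fcol : {set 'I_r} -> {ffun 'I_r -> 'I_h} -> nat)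
    (inv : {set 'I_r} -> option nat) (iota : {set 'I_r} -> nat -> nat)
    (G : {set 'I_r} -> vtuple T -> nat) (phi : pmap h T) : bool :=
  [forall I : {set 'I_r}, (#|I| == k) ==>
    [forall u : {ffun 'I_r -> 'I_h},
      (Some (Fcol I u) != inv I) ==> (G I (phimap phi u) == iota I (Fcol I u))]].

Definition hom_prob (r k h : nat) (T : 'I_r -> finType)
    (mu : forall i, T i -> R)
    (Fcol : {set 'I_r} -> {ffun 'I_r -> 'I_h} -> nat)
    (inv : {set 'I_r} -> option nat) (iota : {set 'I_r} -> nat -> nat)
    (G : {set 'I_r} -> vtuple T -> nat) : R :=
  \sum_(phi : pmap h T | hom_event k Fcol inv iota G phi) map_weight mu phi.

(* Main.v *)
Require Import Defs.
From HB Require Import structures.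
From mathcomp Require Import all_boot all_order all_algebra.
From Stdlib Require Import Rdefinitions.
From mathcomp Require Import Rstruct.
From mathcomp Require Import ring lra zify.
From mathcomp Require boolp.
Import Order.TTheory GRing.Theory Num.Theory.
Local Open Scope ring_scope.

Set Implicit Arguments.
Unset Strict Implicit.
Unset Printing Implicit Defensive.

(** Give every vertex of [F] its own part: with [J] the set of all vertices of [F],
    a random map [phi] is a random point of a product space indexed by [J], each visible
    edge of [F] is a [k]-subset [e] of [J], and the event to be avoided is an
    intersection of sets [A e], each depending only on the coordinates in [e].

    From size [k] downwards, the colorings of the [j.+1]-subsets are regularized by
    colorings of the [j]-subsets: a coarse coloring [p] and a much finer one such that
    the conditional densities given both are close in mean square, while each color
    class minus its fine conditional density is nearly orthogonal to all products of
    functions missing one coordinate, with an error as small as desired in terms of the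
    number of colors of [p].  Removing the edges with a face of low relative density, or
    on whose cell the two densities differ, costs little.  If some point survives in all
    the sets [A e], the colors it sees form a pattern whose probability is nearly
    the product of its relative densities, hence bounded below; otherwise the removed
    edges meet every copy of [F], and recoloring them with a color not used by [F]
    destroys all copies.

    In the counting estimate the coarse density replaces the fine one at the cost of a
    second moment, which is the probability of two copies of the pattern glued along an
    edge; so patterns have to be counted in blow-ups [J * L] for all finite [L]. *)

(** * Means on finite product spaces *)

Lemma prod_le1 (R : realFieldType) (I : Type) (r : seq I) (P : pred I) (F : I -> R) :
  (forall i, P i -> 0 <= F i <= 1) -> \prod_(i <- r | P i) F i <= 1.
Proof.
move=> F01; apply: le_trans (ler_prod _ (E2 := fun=> 1) F01) _.
by rewrite big1.
Qed.

Section Mean.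
Variables (R : realFieldType) (S : finType) (w : S -> R).

Definition mean (F : S -> R) : R := \sum_x w x * F x.

Lemma eq_mean F G : F =1 G -> mean F = mean G.
Proof. by move=> FG; apply: eq_bigr => x _; rewrite FG. Qed.

Lemma meanD F G : mean (fun x => F x + G x) = mean F + mean G.
Proof. by rewrite -big_split; apply: eq_bigr => x _; rewrite mulrDr. Qed.

Lemma meanZ c F : mean (fun x => c * F x) = c * mean F.
Proof. by rewrite mulr_sumr; apply: eq_bigr => x _; rewrite mulrCA. Qed.

Lemma meanB F G : mean (fun x => F x - G x) = mean F - mean G.
Proof. by rewrite -sumrB; apply: eq_bigr => x _; rewrite mulrBr. Qed.

Lemma mean_sum (I : Type) (r : seq I) (P : pred I) (F : I -> S -> R) :
  mean (fun x => \sum_(i <- r | P i) F i x) = \sum_(i <- r | P i) mean (F i).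
Proof. by rewrite exchange_big; apply: eq_bigr => x _; rewrite mulr_sumr. Qed.

Hypothesis w_ge0 : forall x, 0 <= w x.

Lemma le_mean F G : (forall x, F x <= G x) -> mean F <= mean G.
Proof. by move=> FG; apply: ler_sum => x _; apply: ler_wpM2l. Qed.

Lemma mean_ge0 F : (forall x, 0 <= F x) -> 0 <= mean F.
Proof. by move=> F0; apply: sumr_ge0 => x _; apply: mulr_ge0. Qed.

Lemma norm_mean F : `|mean F| <= mean (fun x => `|F x|).
Proof.
apply: le_trans (ler_norm_sum _ _ _) _; apply: ler_sum => x _.
by rewrite normrM (ger0_norm (w_ge0 x)).
Qed.

Lemma mean_norm_le F c : \sum_x w x = 1 -> (forall x, `|F x| <= c) ->
  `|mean F| <= c.
Proof.
move=> w1 Fc; apply: le_trans (norm_mean F) _.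
apply: le_trans (le_mean (G := fun=> c) Fc) _.
by rewrite /mean -mulr_suml w1 mul1r.
Qed.

(** Lagrange's identity: the difference of the two sides is half a weighted sum of the squares of
    [F x * G y - F y * G x], seen by adding to the double sum its copy with [x] and [y]
    exchanged. *)
Lemma mean_cauchy_schwarz F G :
  mean (fun x => F x * G x) ^+ 2
  <= mean (fun x => F x ^+ 2) * mean (fun x => G x ^+ 2).
Proof.
rewrite expr2 /mean !big_distrlr /= -subr_ge0 -sumrB.
under eq_bigr do rewrite -sumrB.
set T := \sum_i _; suff -> : T = 2^-1 *
    (\sum_x \sum_y w x * w y * (F x * G y - F y * G x) ^+ 2).
  apply: mulr_ge0; first by lra.
  by apply: sumr_ge0 => x _; apply: sumr_ge0 => y _; rewrite mulr_ge0 ?sqr_ge0 // mulr_ge0.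
have e : T + T = \sum_x \sum_y w x * w y * (F x * G y - F y * G x) ^+ 2.
  rewrite {2}/T exchange_big /= -big_split; apply: eq_bigr => x _ /=.
  by rewrite -big_split; apply: eq_bigr => y _ /=; ring.
by rewrite -e; lra.
Qed.

Lemma norm_mean_le F c : \sum_x w x = 1 -> 0 <= c ->
  mean (fun x => F x ^+ 2) <= c ^+ 2 -> `|mean F| <= c.
Proof.
move=> w1 c0 Fc; rewrite -ler_sqr ?nnegrE // real_normK ?num_real //.
have := mean_cauchy_schwarz F (fun=> 1).
have -> : mean (fun=> 1 ^+ 2) = 1.
  by rewrite -[RHS]w1; apply: eq_bigr => x _ /=; ring.
have -> : mean (fun x => F x * 1) = mean F by apply: eq_mean => x; rewrite mulr1.
by rewrite mulr1 => /le_trans; apply.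
Qed.

Section CondMean.
Variables (K : eqType) (key : S -> K).

(* Since [x / 0 = 0], [cmean] vanishes on the cells of weight zero. *)
Definition cmean (F : S -> R) (x : S) : R :=
  mean (fun y => (key y == key x)%:R * F y) / mean (fun y => (key y == key x)%:R).

Lemma cmean_key F x y : key x = key y -> cmean F x = cmean F y.
Proof. by rewrite /cmean => ->. Qed.

(** The conditional mean is the orthogonal projection onto the functions of [key], so it is
    invisible to a test function [G] of that kind. *)
Lemma mean_cmean F G : (forall x y, key x = key y -> G x = G y) ->
  mean (fun x => cmean F x * G x) = mean (fun x => F x * G x).
Proof.
move=> Gkey; rewrite /cmean {1}/mean.
under eq_bigr => x _.
  rewrite -mulrA mulrC {1}/mean mulr_suml mulr_suml.
  over.
rewrite exchange_big /=; apply: eq_bigr => y _.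
rewrite (eq_bigr (fun x => w y * F y * G y *
    (w x * (key x == key y)%:R / mean (fun z => (key z == key y)%:R)))).
  rewrite -mulr_sumr -mulr_suml.
  (* A point of positive weight lies in a cell of positive weight, so the convention for division by
     zero does no harm. *)
  have [->|wy] := eqVneq (w y) 0; first by rewrite !mul0r.
  rewrite -/(mean (fun x => (key x == key y)%:R)) mulfV ?mulr1 ?mulrA //.
  apply/eqP => m0; move/eqP: wy; apply.
  apply/eqP; rewrite eq_le w_ge0 andbT -m0 /mean (bigD1 y) //= eqxx mulr1.
  by rewrite lerDl; apply: sumr_ge0 => x _; rewrite mulr_ge0 // ler0n.
move=> x _; rewrite (eq_sym (key x)).
have [e|ne] := eqVneq (key y) (key x); last by rewrite !(mulr0, mul0r).
rewrite e (Gkey _ _ e); ring.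
Qed.

Lemma cmean_ge0 F x : (forall y, 0 <= F y) -> 0 <= cmean F x.
Proof.
by move=> F0; rewrite /cmean divr_ge0 // mean_ge0 // => y; rewrite ?mulr_ge0 // ler0n.
Qed.

Lemma cmean_le1 F x : (forall y, F y <= 1) -> cmean F x <= 1.
Proof.
move=> F1; rewrite /cmean; set m := mean (fun y => (key y == key x)%:R).
have m0 : 0 <= m by apply: mean_ge0 => y; rewrite ler0n.
have [->|nz] := eqVneq m 0; first by rewrite invr0 mulr0.
rewrite ler_pdivrMr ?mul1r ?lt_def ?nz //; apply: le_mean => y.
by case: (key y == _); rewrite ?mul1r ?mul0r.
Qed.

End CondMean.

(** Pythagoras: [k2] being finer, [cmean k1 F] is also the projection of [cmean k2 F]. *)
Lemma cmean_refine (K1 K2 : eqType) (k1 : S -> K1) (k2 : S -> K2) F :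
  (forall x y, k2 x = k2 y -> k1 x = k1 y) ->
  mean (fun x => (cmean k2 F x - cmean k1 F x) ^+ 2)
  = mean (fun x => cmean k2 F x ^+ 2) - mean (fun x => cmean k1 F x ^+ 2).
Proof.
move=> ref.
have e : mean (fun x => cmean k2 F x * cmean k1 F x) = mean (fun x => cmean k1 F x ^+ 2).
  rewrite mean_cmean; last by move=> x y e; apply: cmean_key; apply: ref.
  by rewrite -(mean_cmean (key := k1)) //; apply: cmean_key.
transitivity (mean (fun x => cmean k2 F x ^+ 2) + mean (fun x => cmean k1 F x ^+ 2)
   - 2 * mean (fun x => cmean k2 F x * cmean k1 F x)); last by rewrite e; ring.
by rewrite -meanZ -meanD -meanB; apply: eq_mean => x; ring.
Qed.

(** Since [u] is a function of [k2], the correlation is unchanged when [F] becomes [cmean k2 F];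
    Cauchy-Schwarz and Pythagoras then turn it into a gain in mean square. *)
Lemma cmean_increment (K1 K2 : eqType) (k1 : S -> K1) (k2 : S -> K2) F u eta :
  \sum_x w x = 1 ->
  (forall x y, k2 x = k2 y -> k1 x = k1 y) ->
  (forall x y, k2 x = k2 y -> u x = u y) ->
  (forall x, `|u x| <= 1) -> 0 <= eta ->
  eta < `|mean (fun x => (F x - cmean k1 F x) * u x)| ->
  mean (fun x => cmean k1 F x ^+ 2) + eta ^+ 2
  <= mean (fun x => cmean k2 F x ^+ 2).
Proof.
move=> w1 ref uk u1 eta0 big.
rewrite -lerBrDl -cmean_refine //.
rewrite leNgt; apply/negP => small; move: big; rewrite ltNge => /negP; apply.
have -> : mean (fun x => (F x - cmean k1 F x) * u x) =
          mean (fun x => (cmean k2 F x - cmean k1 F x) * u x).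
  transitivity (mean (fun x => F x * u x) - mean (fun x => cmean k1 F x * u x)).
    by rewrite -meanB; apply: eq_mean => x; ring.
  by rewrite -(mean_cmean (key := k2)) // -meanB; apply: eq_mean => x; ring.
apply: norm_mean_le => //; apply: le_trans (ltW small).
apply: le_mean => x; rewrite exprMn ler_piMr ?sqr_ge0 //.
by rewrite -real_normK ?num_real // expr_le1.
Qed.

End Mean.

Definition pweight (R : realFieldType) (X V : finType) (mu : V -> X -> R)
  (x : {ffun V -> X}) : R := \prod_v mu v (x v).

Definition prob_family (R : realFieldType) (X V : finType) (mu : V -> X -> R) :=
  (forall v x, 0 <= mu v x) /\ (forall v, \sum_x mu v x = 1).

Section ProductMean.
Variables (R : realFieldType) (X : finType).

Definition pmean (V : finType) (mu : V -> X -> R) (F : {ffun V -> X} -> R) : R :=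
  mean (pweight mu) F.

Lemma pweight_ge0 (V : finType) (mu : V -> X -> R) x :
  prob_family mu -> 0 <= pweight mu x.
Proof. by case=> mu0 _; apply: prodr_ge0. Qed.

Lemma pweight_sum (V : finType) (mu : V -> X -> R) :
  prob_family mu -> \sum_x pweight mu x = 1.
Proof.
by case=> _ mu1; rewrite -(bigA_distr_bigA mu) /= big1 // => v _; rewrite mu1.
Qed.

Lemma pmean_cst (V : finType) (mu : V -> X -> R) c :
  prob_family mu -> pmean mu (fun=> c) = c.
Proof. by move=> pf; rewrite /pmean /mean -mulr_suml pweight_sum // mul1r. Qed.

(** Distinct coordinates of a product measure are independent, so reading along an injection gives a
    product measure again. *)
Lemma pmean_inj (V W : finType) (s : V -> W) (mu : W -> X -> R)
    (F : {ffun V -> X} -> R) : injective s -> prob_family mu ->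
  pmean mu (fun y => F [ffun v => y (s v)]) = pmean (fun v => mu (s v)) F.
Proof.
move=> sI [mu0 mu1]; rewrite /pmean /mean.
transitivity (\sum_y \sum_a pweight mu y * ([ffun v => y (s v)] == a)%:R * F a).
  apply: eq_bigr => y _; rewrite (bigD1 [ffun v => y (s v)]) //= eqxx mulr1.
  rewrite big1 ?addr0 // => a; rewrite eq_sym => /negPf ->.
  by rewrite mulr0 mul0r.
rewrite exchange_big; apply: eq_bigr => a _ /=; rewrite -mulr_suml; congr (_ * _).
(* The indicator is spread over the coordinates of [W] so that the sum over [y] factors; coordinates
   outside the image of [s] then contribute 1. *)
transitivity (\sum_(y : {ffun W -> X})
   \prod_u (mu u (y u) * \prod_(v | s v == u) (y u == a v)%:R)).
  apply: eq_bigr => y _; rewrite big_split /=; congr (_ * _).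
  transitivity (\prod_v (y (s v) == a v)%:R : R).
    case: eqP => [<-|ne]; first by rewrite big1 // => v _; rewrite ffunE eqxx.
    have : ~~ [forall v, y (s v) == a v].
      by apply/negP => /forallP h; apply: ne; apply/ffunP => v; rewrite ffunE; apply/eqP.
    by rewrite negb_forall => /existsP[v /negPf hv]; rewrite (bigD1 v) //= hv mul0r.
  rewrite (partition_big s predT) //=; apply: eq_bigr => u _.
  by apply: eq_bigr => v /eqP ->.
rewrite -(bigA_distr_bigA (fun u x => mu u x * \prod_(v | s v == u) (x == a v)%:R)) /=.
rewrite (bigID (fun u => u \in codom s)) /= [X in _ * X]big1 ?mulr1; last first.
  move=> u nu; rewrite -[RHS](mu1 u); apply: eq_bigr => x _.
  rewrite big1 ?mulr1 // => v /eqP e; case/negP: nu.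
  by rewrite -e codom_f.
rewrite (reindex_omap s (fun u => [pick v | s v == u])) /=; last first.
  move=> u /codomP[v ->]; case: pickP => [v' /eqP <- //|/(_ v)].
  by rewrite eqxx.
apply: eq_big => [v|v _].
  rewrite codom_f /=; case: pickP => [v' /eqP /sI -> |/(_ v)]; last by rewrite eqxx.
  by rewrite eqxx.
rewrite (bigD1 (a v)) //= [X in _ + X]big1 ?addr0.
  rewrite big1 ?mulr1 // => v' /eqP /sI ->; by rewrite eqxx.
move=> x /negPf ne; by rewrite (bigD1 v) //= ne mul0r mulr0.
Qed.



Lemma eq_pmean (V : finType) (mu mu' : V -> X -> R) F F' :
  mu =2 mu' -> F =1 F' -> pmean mu F = pmean mu' F'.
Proof.
move=> emu eF; apply: eq_bigr => x _; rewrite eF; congr (_ * _).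
by apply: eq_bigr => v _; rewrite emu.
Qed.

Lemma pmean_sum (V W : finType) (mu : V + W -> X -> R)
    (F : {ffun V -> X} -> {ffun W -> X} -> R) :
  pmean mu (fun x => F [ffun v => x (inl v)] [ffun v => x (inr v)])
  = pmean (fun v => mu (inl v)) (fun y => pmean (fun v => mu (inr v)) (F y)).
Proof.
pose glue (p : {ffun V -> X} * {ffun W -> X}) : {ffun V + W -> X} :=
  [ffun v => match v with inl a => p.1 a | inr b => p.2 b end].
pose cut (x : {ffun V + W -> X}) := ([ffun v => x (inl v)], [ffun v => x (inr v)]).
have cutK : cancel cut glue by move=> x; apply/ffunP => -[v|v]; rewrite !ffunE.
have glueK : cancel glue cut.
  by move=> [y z]; congr pair; apply/ffunP => v; rewrite !ffunE.
rewrite {1}/pmean /mean (reindex glue); last by exists cut => x _; [exact: glueK|exact: cutK].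
pose H y z := pweight mu (glue (y, z))
  * F [ffun v => glue (y, z) (inl v)] [ffun v => glue (y, z) (inr v)].
rewrite -(pair_big predT predT H) /=.
apply: eq_bigr => y _; rewrite /pmean /mean mulr_sumr; apply: eq_bigr => z _.
rewrite mulrA; congr (_ * _); last first.
  by congr F; apply/ffunP => v; rewrite !ffunE.
rewrite /pweight big_sumType /=.
by congr (_ * _); apply: eq_bigr => v _; rewrite ffunE.
Qed.

End ProductMean.

(* [e : partial_map J L] encodes the edge of the blow-up [J * L] formed by the
   vertices [(i, l)] with [e i = Some l]. *)
Definition partial_map (J L : finType) := {ffun J -> option L}.

Definition splice (J L X : finType) (e : partial_map J L)
    (y : {ffun J * L -> X}) (z : {ffun J -> X}) : {ffun J * L -> X} :=
  [ffun p => if e p.1 == Some p.2 then z p.1 else y p].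

Section Blowup.
Variables (R : realFieldType) (J X : finType) (nu : J -> X -> R).
Hypothesis nu_prob : prob_family nu.

Definition blowup_family (L : finType) (p : J * L) : X -> R := nu p.1.

Lemma blowup_prob L : prob_family (@blowup_family L).
Proof. by case: nu_prob => h0 h1; split=> p; [move=> x; apply: h0|apply: h1]. Qed.

(** Resampling the vertices of [e] preserves the law: [e] has at most one vertex over each [i], so
    the variables read by [s] are distinct, and the fresh ones have the same law. *)
Lemma pmean_splice (L : finType) (e : partial_map J L) F :
  pmean nu (fun z => pmean (@blowup_family L) (fun y => F (splice e y z)))
  = pmean (@blowup_family L) F.
Proof.
pose mu (v : J + J * L) : X -> R := match v with inl i => nu i | inr p => nu p.1 end.
pose s (p : J * L) : J + J * L := if e p.1 == Some p.2 then inl p.1 else inr p.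
have mup : prob_family mu.
  by case: nu_prob => h0 h1; split=> -[i|p] //=.
have sI : injective s.
  move=> [i l] [i' l']; rewrite /s /=.
  case: eqP => [e1|_]; case: eqP => [e2|_] //; last by move=> [-> ->].
  move=> [ii]; by move: e1; rewrite ii e2 => -[->].
rewrite -(pmean_sum mu (fun z y => F (splice e y z))).
rewrite -[RHS](@eq_pmean _ _ _ (fun p => mu (s p)) _ F) //; last first.
  by move=> [i l] x; rewrite /s /=; case: eqP.
rewrite -pmean_inj //; apply: eq_pmean => // x; congr F.
by apply/ffunP => p; rewrite !ffunE /s; case: eqP.
Qed.

(** The second copy of [J * L], glued to the first (the [inl] layers) exactly along the vertices of
    [e]. *)
Definition double_right (L : finType) (e : partial_map J L) (p : J * L) :
  J * (L + L) := (p.1, if e p.1 == Some p.2 then inl p.2 else inr p.2).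

(** The square runs two independent copies of [y] over a common [z], and [z] sits on the vertices of
    [e] that the two copies share. *)
Lemma pmean_double (L : finType) (e : partial_map J L) (F : {ffun J * L -> X} -> R) :
  pmean nu (fun z => pmean (@blowup_family L) (fun y => F (splice e y z)) ^+ 2)
  = pmean (@blowup_family (L + L)%type) (fun Y =>
      F [ffun p => Y (p.1, inl p.2)] * F [ffun p => Y (double_right e p)]).
Proof.
pose mu2 (v : J * L + J * L) : X -> R := match v with inl p => nu p.1 | inr p => nu p.1 end.
pose mu (v : J + (J * L + J * L)) : X -> R :=
  match v with inl i => nu i | inr p => mu2 p end.
pose s (p : J * (L + L)) : J + (J * L + J * L) :=
  match p.2 with
  | inl l => if e p.1 == Some l then inl p.1 else inr (inl (p.1, l))
  | inr l => inr (inr (p.1, l)) end.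
have mup : prob_family mu.
  by case: nu_prob => h0 h1; split=> -[i|[p|p]] //=.
have sI : injective s.
  move=> [i [l|l]] [i' [l'|l']]; rewrite /s /=; try (by case: eqP);
    try by move=> [-> ->].
  case: eqP => [e1|_]; case: eqP => [e2|_] //; last by move=> [-> ->].
  move=> [ii]; by move: e1; rewrite ii e2 => -[->].
pose G z y y' := F (splice e y z) * F (splice e y' z).
transitivity (pmean nu (fun z => pmean mu2 (fun w =>
    G z [ffun v => w (inl v)] [ffun v => w (inr v)]))).
  apply: eq_pmean => // z; rewrite pmean_sum /G expr2.
  transitivity (pmean (@blowup_family L) (fun y => F (splice e y z) *
     pmean (@blowup_family L) (fun y => F (splice e y z)))).
    rewrite mulrC /pmean -meanZ; apply: eq_mean => y; by rewrite mulrC.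
  by apply: eq_pmean => // y; rewrite /pmean meanZ.
rewrite -(pmean_sum mu (fun z w => G z [ffun v => w (inl v)] [ffun v => w (inr v)])).
pose H (Y : {ffun J * (L + L) -> X}) :=
  F [ffun p => Y (p.1, inl p.2)] * F [ffun p => Y (double_right e p)].
rewrite -[RHS](@eq_pmean _ _ _ (fun p => mu (s p)) _ H) //; last first.
  by move=> [i [l|l]] x; rewrite /s //=; case: eqP.
rewrite -pmean_inj //; apply: eq_pmean => // x; rewrite /G /H.
congr (F _ * F _); apply/ffunP => -[i l]; rewrite !ffunE /s /double_right /=;
  by case: ifP => //= h; rewrite ?h .
Qed.

End Blowup.

(** * Regularization of colorings *)

Section Colorings.
Variables (R : archiRealFieldType) (J : finType).

Definition dep_on (X : finType) (Y : Type) (f : {set J}) (F : {ffun J -> X} -> Y) :=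
  forall x y : {ffun J -> X}, (forall i, i \in f -> x i = y i) -> F x = F y.

Definition coloring (X : finType) (j m : nat) (c : {set J} -> {ffun J -> X} -> nat) :=
  forall f : {set J}, #|f| = j -> dep_on f (c f) /\ forall x, (c f x < m)%nat.

(** The joint color of the facets of [f], meant as a key for [cmean]; the zeros outside [f] are
    padding. *)
Definition face_colors (X : finType) (c : {set J} -> {ffun J -> X} -> nat)
    (f : {set J}) (x : {ffun J -> X}) : {ffun J -> nat} :=
  [ffun v => if v \in f then c (f :\ v) x else 0%nat].

Definition color_ind (X : finType) (c : {set J} -> {ffun J -> X} -> nat)
    (f : {set J}) (a : nat) (x : {ffun J -> X}) : R := (c f x == a)%:R.

Definition density (X : finType) (nu : J -> X -> R)
    (p c : {set J} -> {ffun J -> X} -> nat) (f : {set J}) (a : nat) :=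
  cmean (pweight nu) (face_colors p f) (color_ind c f a).

(** The cut-norm form of hypergraph quasirandomness: each factor of a test misses one vertex of
    [f]. *)
Definition uniform (X : finType) (nu : J -> X -> R) (f : {set J})
    (phi : {ffun J -> X} -> R) (eta : R) :=
  forall u : J -> {ffun J -> X} -> bool, (forall i, i \in f -> dep_on (f :\ i) (u i)) ->
  `|pmean nu (fun x => phi x * (\prod_(i in f) (u i x)%:R))| <= eta.

(** The index of regularity lemmas: refining [p] cannot lower it, and it is bounded independently of
    the space. *)
Definition energy (X : finType) (nu : J -> X -> R) (j m : nat)
    (c p : {set J} -> {ffun J -> X} -> nat) : R :=
  \sum_(fa : {set J} * 'I_m | #|fa.1| == j)
    pmean nu (fun x => density nu p c fa.1 fa.2 x ^+ 2).

Definition refines (X : finType) (j : nat) (q p : {set J} -> {ffun J -> X} -> nat) :=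
  forall g : {set J}, #|g| = j -> forall x y, q g x = q g y -> p g x = p g y.

Lemma face_colors_inj (X : finType) (p : {set J} -> {ffun J -> X} -> nat) (f : {set J}) x y :
  face_colors p f x = face_colors p f y <->
  (forall v, v \in f -> p (f :\ v) x = p (f :\ v) y).
Proof.
split=> [/ffunP e v vf|e]; first by move: (e v); rewrite !ffunE vf.
by apply/ffunP => v; rewrite !ffunE; case: ifP => // /e.
Qed.

Lemma face_colors_refines (X : finType) j q p (f : {set J}) (x y : {ffun J -> X}) :
  refines j q p -> #|f| = j.+1 ->
  face_colors q f x = face_colors q f y -> face_colors p f x = face_colors p f y.
Proof.
move=> ref fj /face_colors_inj e; apply/face_colors_inj => v vf.
by apply: ref (e v vf); move: fj; rewrite (cardsD1 v) vf => -[].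
Qed.

Lemma face_colors_dep (X : finType) j m (p : {set J} -> {ffun J -> X} -> nat) (f : {set J}) :
  coloring j m p -> #|f| = j.+1 -> dep_on f (face_colors p f).
Proof.
move=> pc fj x y xy; apply/face_colors_inj => v vf.
have [|dp _] := pc (f :\ v); first by move: fj; rewrite (cardsD1 v) vf => -[].
by apply: dp => i /setD1P[_]; apply: xy.
Qed.

Lemma density_ge0 (X : finType) (nu : J -> X -> R) p c f a x :
  prob_family nu -> 0 <= density nu p c f a x.
Proof.
by move=> np; apply: cmean_ge0 => [y|y]; rewrite ?pweight_ge0 // ler0n.
Qed.

Lemma density_le1 (X : finType) (nu : J -> X -> R) p c f a x :
  prob_family nu -> density nu p c f a x <= 1.
Proof.
by move=> np; apply: cmean_le1 => [y|y]; rewrite ?pweight_ge0 // /color_ind lern1 leq_b1.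
Qed.

Lemma energy_le (X : finType) (nu : J -> X -> R) j m c p :
  prob_family nu -> energy nu j m c p <= #|{: {set J} * 'I_m}|%:R.
Proof.
move=> np; rewrite -sumr_const /energy big_mkcond; apply: ler_sum => fa _.
case: ifP => // _; apply: le_trans (ler_norm _) _.
apply: mean_norm_le; rewrite ?pweight_sum // => x; first exact: pweight_ge0.
by rewrite ger0_norm ?sqr_ge0 // expr_le1 ?density_ge0 ?density_le1.
Qed.

Lemma pmean_density_refines (X : finType) (nu : J -> X -> R) j c p q (f : {set J}) a :
  prob_family nu -> refines j q p -> #|f| = j.+1 ->
  pmean nu (fun x => (density nu q c f a x - density nu p c f a x) ^+ 2)
  = pmean nu (fun x => density nu q c f a x ^+ 2)
    - pmean nu (fun x => density nu p c f a x ^+ 2).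
Proof.
move=> np ref fj; apply: cmean_refine; first by move=> x; apply: pweight_ge0.
by move=> x y; apply: face_colors_refines ref fj.
Qed.

(** A gain in one term survives in the sum, because by Pythagoras no other term decreases. *)
Lemma energy_gap (X : finType) (nu : J -> X -> R) j m c p q (f : {set J}) (a : 'I_m) d :
  prob_family nu -> refines j q p -> #|f| = j.+1 ->
  pmean nu (fun x => density nu p c f a x ^+ 2) + d
    <= pmean nu (fun x => density nu q c f a x ^+ 2) ->
  energy nu j.+1 m c p + d <= energy nu j.+1 m c q.
Proof.
move=> np ref fj h; rewrite /energy.
rewrite (bigD1 (f, a)) /= ?fj ?eqxx // [leRHS](bigD1 (f, a)) /= ?fj ?eqxx //.
rewrite addrAC lerD //; apply: ler_sum => -[g b] /andP[/eqP gj _] /=.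
rewrite -subr_ge0 -(pmean_density_refines _ _ np ref gj).
by apply: mean_ge0 => x; rewrite ?sqr_ge0 ?pweight_ge0.
Qed.

(** The test functions that violate uniformity are recorded as one extra bit in the colors of the
    facets of [f]; they become functions of the refined key and [cmean_increment] applies. *)
Lemma refine_increment (X : finType) (nu : J -> X -> R) j m m0 c p (f : {set J}) (a : 'I_m) eta :
  prob_family nu -> coloring j m0 p -> #|f| = j.+1 -> 0 <= eta ->
  ~ uniform nu f (fun x => color_ind c f a x - density nu p c f a x) eta ->
  exists q, [/\ coloring j m0.*2 q, refines j q p &
    energy nu j.+1 m c p + eta ^+ 2 <= energy nu j.+1 m c q].
Proof.
move=> np pc fj eta0 /boolp.existsNP[u /boolp.not_implyP[udep /negP]].
rewrite -ltNge => big.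
(* The bit of the facet [f :\ i] is [u i]; sets that are not facets of [f] get the bit [false]. *)
pose b g x := [exists i in f, (g == f :\ i) && u i x].
have bE i x : i \in f -> b (f :\ i) x = u i x.
  move=> fi; apply/existsP/idP => [[i' /and3P[fi' /eqP e ui']]|ui]; last first.
    by exists i; rewrite fi eqxx ui.
  suff -> : i = i' by [].
  apply/eqP; apply/negPn/negP => ne.
  have : i' \in f :\ i by rewrite !inE eq_sym ne.
  by rewrite e !inE eqxx.
pose q g x := ((p g x).*2 + b g x)%nat.
have ref : refines j q p.
  move=> g gj x y; rewrite /q => e.
  have : (q g x)./2 = (q g y)./2 by rewrite /q e.
  by rewrite /q ![(_.*2 + _)%nat]addnC !half_bit_double.
exists q; split=> //.
- move=> g gj; have [dp lt] := pc g gj; split=> [x y xy|x]; last first.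
    by rewrite /q; have := lt x; case: (b g x) => /=; lia.
  rewrite /q (dp x y xy); congr (_ + nat_of_bool _)%nat.
  apply: eq_existsb => i; case fi: (i \in f) => //=.
  by case: eqP => //= eg; apply: udep => // i'; rewrite -eg; apply: xy.
- apply: (energy_gap (f := f) (a := a)) => //.
  apply: cmean_increment big => //.
  + by move=> x; apply: pweight_ge0.
  + exact: pweight_sum.
  + by move=> x y; apply: face_colors_refines ref fj.
  + move=> x y /face_colors_inj e; apply: eq_bigr => i fi.
    rewrite -!bE //; congr (nat_of_bool _)%:R.
    have := e i fi; rewrite /q => /(congr1 odd).
    by rewrite !oddD !odd_double /= !oddb.
  + move=> x; rewrite normr_prod; apply: prod_le1 => i _.
    by rewrite normr_nat ler0n lern1 leq_b1.
Qed.

(** Each failure of uniformity gains [eta ^+ 2] of an energy bounded by [B] and doubles the number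
    of colors, so boundedly many doublings suffice. *)
Lemma uniform_refinement (j m m0 : nat) (eta : R) : 0 < eta -> exists m1,
  forall (X : finType) (nu : J -> X -> R) c p,
  prob_family nu -> coloring j m0 p ->
  exists q, [/\ coloring j m1 q, refines j q p &
    forall (f : {set J}) (a : 'I_m), #|f| = j.+1 ->
      uniform nu f (fun x => color_ind c f a x - density nu q c f a x) eta].
Proof.
move=> eta0; set B : R := #|{: {set J} * 'I_m}|%:R.
have [t Bt] : exists t : nat, B < t%:R * eta ^+ 2.
  exists (Num.trunc (B / eta ^+ 2)).+1; rewrite -ltr_pdivrMr ?exprn_gt0 //.
  exact: truncnS_gt.
exists (m0 * expn 2 t)%nat => X nu c p np.
(* The induction invariant: [t] bounds the increments still possible, and [t = 0] contradicts the
   bound [B]. *)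
have : B - t%:R * eta ^+ 2 < energy nu j.+1 m c p.
  apply: lt_le_trans (_ : 0 <= _); first by rewrite subr_lt0.
  apply: sumr_ge0 => fa _; apply: mean_ge0 => x; rewrite ?sqr_ge0 //.
  exact: pweight_ge0.
elim: t m0 p {Bt} => [|t IH] m0 p en pc.
  by move: en; rewrite mul0r subr0 ltNge energy_le.
have [unif|] := boolp.EM (forall (f : {set J}) (a : 'I_m), #|f| = j.+1 ->
      uniform nu f (fun x => color_ind c f a x - density nu p c f a x) eta).
  exists p; split=> // f fj; have [dp lt] := pc f fj; split=> // x.
  by apply: leq_trans (lt x) _; rewrite leq_pmulr ?expn_gt0.
move=> /boolp.existsNP[f /boolp.existsNP[a /boolp.not_implyP[fj nu_f]]].
have [q [qc qp qe]] := refine_increment np pc fj (ltW eta0) nu_f.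
have [|q' [qc' qq' un]] := IH m0.*2 q _ qc.
  by apply: lt_le_trans qe; rewrite -ltrBlDr; apply: le_lt_trans en; rewrite -natr1; lra.
exists q'; split=> //; last by move=> g gj x y /(qq' g gj) /(qp g gj).
by rewrite expnS mulnA muln2.
Qed.

(** A coarse coloring with [m0] colors is refined until its fine densities are uniform up to
    [Phi m0]. If the energy rises by at most [eps], these are the [gamma]; otherwise the fine
    coloring becomes the coarse one, which can happen only boundedly often. *)
Theorem regularity (j m : nat) (eps : R) (Phi : nat -> R) :
  0 < eps -> (forall i, 0 < Phi i) -> exists M,
  forall (X : finType) (nu : J -> X -> R) c,
  prob_family nu -> coloring j.+1 m c ->
  exists m' p gamma, [/\ (m' <= M)%nat, coloring j m' p &
    forall (f : {set J}) (a : nat), #|f| = j.+1 -> (a < m)%nat ->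
    [/\ dep_on f (gamma f a),
       pmean nu (fun x => (gamma f a x - density nu p c f a x) ^+ 2) <= eps &
       uniform nu f (fun x => color_ind c f a x - gamma f a x) (Phi m')]].
Proof.
move=> eps0 Phi0; set B : R := #|{: {set J} * 'I_m}|%:R.
have [t Bt] : exists t : nat, B < t%:R * eps.
  exists (Num.trunc (B / eps)).+1; rewrite -ltr_pdivrMr //.
  exact: truncnS_gt.
suff ind : forall m0, exists M, forall (X : finType) (nu : J -> X -> R) c p0,
  prob_family nu -> coloring j.+1 m c -> coloring j m0 p0 ->
  B - t%:R * eps < energy nu j.+1 m c p0 ->
  exists m' p gamma, [/\ (m' <= M)%nat, coloring j m' p &
    forall (f : {set J}) (a : nat), #|f| = j.+1 -> (a < m)%nat ->
    [/\ dep_on f (gamma f a),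
       pmean nu (fun x => (gamma f a x - density nu p c f a x) ^+ 2) <= eps &
       uniform nu f (fun x => color_ind c f a x - gamma f a x) (Phi m')]].
  (* The iteration starts from the coloring with a single color. *)
  have [M hM] := ind 1%nat.
  exists M => X nu c np cc; apply: (hM X nu c (fun _ _ => 0%nat)) => //.
  apply: lt_le_trans (_ : 0 <= _); first by rewrite subr_lt0.
  apply: sumr_ge0 => fa _; apply: mean_ge0 => x; rewrite ?sqr_ge0 //.
  exact: pweight_ge0.
elim: t {Bt} => [|t IH] m0.
  by exists 0%nat => X nu c p0 np _ _; rewrite mul0r subr0 ltNge energy_le.
have [m1 hm1] := uniform_refinement j m m0 (Phi0 m0).
have [M hM] := IH m1.
exists (maxn m0 M) => X nu c p np cc pc en.
have [q [qc qp un]] := hm1 X nu c p np pc.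
have [big|small] := ltP (energy nu j.+1 m c p + eps) (energy nu j.+1 m c q).
  have [|m' [p' [ga [m'M pc' hp']]]] := hM X nu c q np cc qc.
    by apply: lt_trans big; rewrite -ltrBlDr; apply: le_lt_trans en; rewrite -natr1; lra.
  exists m', p', ga; split; [by rewrite leq_max m'M orbT|exact: pc'|exact: hp'].
exists m0, p, (density nu q c); split; [by rewrite leq_max leqnn|by []|].
move=> f a fj am; split; last exact: (un f (Ordinal am)).
- by move=> x y xy; apply: cmean_key; apply: face_colors_dep qc fj _ _ xy.
- rewrite (pmean_density_refines _ _ np qp fj) leNgt; apply/negP => gt.
  move: small; apply/negP; rewrite -ltNge.
  pose d := pmean nu (fun x => density nu q c f a x ^+ 2)
    - pmean nu (fun x => density nu p c f a x ^+ 2).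
  apply: lt_le_trans (_ : energy nu j.+1 m c p + d <= _); first by rewrite ltrD2l.
  by apply: (energy_gap (f := f) (a := Ordinal am)) => //=; rewrite /d; lra.
Qed.

End Colorings.

(** * Counting patterns in blow-ups *)

Lemma prod_bool_seq (R : comNzRingType) (I : Type) (s : seq I) (b : pred I) :
  \prod_(i <- s) (b i)%:R = (all b s)%:R :> R.
Proof.
elim: s => [|i s IH] /=; first by rewrite big_nil.
by rewrite big_cons IH; case: (b i); rewrite ?mul1r ?mul0r.
Qed.

Lemma prod_bool (R : comNzRingType) (I : finType) (A b : pred I) :
  \prod_(i in A) (b i)%:R = [forall i in A, b i]%:R :> R.
Proof.
rewrite -big_enum prod_bool_seq; congr (nat_of_bool _)%:R.
apply/allP/forall_inP => h i; first by move=> iA; apply: h; rewrite mem_enum.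
by rewrite mem_enum; apply: h.
Qed.

Section Edges.
Variables (J L : finType).

Definition edge_dom (e : partial_map J L) : {set J} := [set i | e i != None].

Definition restrict (e : partial_map J L) (g : {set J}) : partial_map J L :=
  [ffun i => if i \in g then e i else None].

Definition complex (H : {set partial_map J L}) :=
  forall e g, e \in H -> restrict e g \in H.

Lemma edge_dom_restrict e g : edge_dom (restrict e g) = g :&: edge_dom e.
Proof. by apply/setP => i; rewrite !inE ffunE; case: (i \in g). Qed.

(* The default values [x] lie outside the domain of [e], where no color of [e] looks. *)
Definition pull (X : finType) (x : {ffun J -> X}) (e : partial_map J L)
    (y : {ffun J * L -> X}) : {ffun J -> X} :=
  [ffun i => if e i is Some l then y (i, l) else x i].

(** The reference point [x] prescribes the pattern: the edge [e] must show in [y] the color that its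
    projection to [J] has at [x]. *)
Definition hit (X : finType) (c : {set J} -> {ffun J -> X} -> nat) x e y :=
  c (edge_dom e) (pull x e y) == c (edge_dom e) x.

Definition pattern_ind (R : realFieldType) (X : finType)
    (c : {set J} -> {ffun J -> X} -> nat) x (H : {set partial_map J L}) y : R :=
  \prod_(e in H) (hit c x e y)%:R.

Lemma pattern_indE R (X : finType) c (x : {ffun J -> X}) H y :
  pattern_ind R c x H y = [forall e in H, hit c x e y]%:R.
Proof. exact: (prod_bool _ (mem H)). Qed.

Lemma lift_splice (X : finType) (x z : {ffun J -> X}) e y i :
  i \in edge_dom e -> pull x e (splice e y z) i = z i.
Proof.
by rewrite inE ffunE; case ei: (e i) => [l|] // _; rewrite ffunE /= ei eqxx.
Qed.

(** The cell of [x] for the colors of all proper subsets of [f], not of its facets alone. *)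
Definition facet_ind (R : realFieldType) (X : finType)
    (c : {set J} -> {ffun J -> X} -> nat) (f : {set J}) (x z : {ffun J -> X}) : R :=
  [forall g : {set J}, (g \proper f) ==> (c g z == c g x)]%:R.

End Edges.

Definition edge_map (J L L' : finType) (s : J -> L -> L') (e : partial_map J L) :
  partial_map J L' := [ffun i => omap (s i) (e i)].

Lemma edge_map_inj (J L L' : finType) (s : J -> L -> L') :
  (forall i, injective (s i)) -> injective (edge_map s).
Proof.
move=> sI e e' /ffunP ee; apply/ffunP => i; move: (ee i); rewrite !ffunE.
by case: (e i) => [l|]; case: (e' i) => [l'|] //= [/sI ->].
Qed.

Lemma edge_dom_map (J L L' : finType) (s : J -> L -> L') e :
  edge_dom (edge_map s e) = edge_dom e.
Proof. by apply/setP => i; rewrite !inE ffunE; case: (e i). Qed.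

Lemma restrict_map (J L L' : finType) (s : J -> L -> L') e g :
  restrict (edge_map s e) g = edge_map s (restrict e g).
Proof. by apply/ffunP => i; rewrite !ffunE; case: (i \in g). Qed.

Lemma complex_map (J L L' : finType) (s : J -> L -> L') (H : {set partial_map J L}) :
  complex H -> complex (edge_map s @: H).
Proof.
move=> cH _ g /imsetP[e eH ->]; rewrite restrict_map imset_f //; exact: cH.
Qed.

Lemma hit_map (J L L' X : finType) (s : J -> L -> L')
    (c : {set J} -> {ffun J -> X} -> nat) x e (Y : {ffun J * L' -> X}) :
  hit c x (edge_map s e) Y = hit c x e [ffun p => Y (p.1, s p.1 p.2)].
Proof.
rewrite /hit edge_dom_map; congr (c _ _ == _).
by apply/ffunP => i; rewrite !ffunE; case: (e i) => [l|] //=; rewrite ffunE.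
Qed.

Section Counting.
Variables (R : archiRealFieldType) (J X : finType) (nu : J -> X -> R).
Hypothesis nu_prob : prob_family nu.
Variable (c : {set J} -> {ffun J -> X} -> nat).

Lemma pmean_lift (L : finType) (e : partial_map J L) (f : {set J}) x
    (F : {ffun J -> X} -> R) : edge_dom e = f -> dep_on f F ->
  pmean (@blowup_family R J X nu L) (fun y => F (pull x e y)) = pmean nu F.
Proof.
move=> ef Fd; rewrite -(pmean_splice nu_prob e); apply: eq_pmean => // z.
rewrite -[RHS](@pmean_cst R X _ (@blowup_family R J X nu L)); last exact: blowup_prob.
apply: eq_pmean => // y; apply: Fd => i; rewrite -ef; exact: lift_splice.
Qed.

Lemma pmean_exchange (V W : finType) (mu : V -> X -> R) (mu' : W -> X -> R) F :
  pmean mu (fun y => pmean mu' (F y)) = pmean mu' (fun z => pmean mu (F^~ z)).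
Proof.
rewrite /pmean /mean; under eq_bigr do rewrite mulr_sumr.
rewrite exchange_big; apply: eq_bigr => z _; rewrite mulr_sumr.
by apply: eq_bigr => y _; rewrite mulrCA.
Qed.

(* An edge other than [e] of at most the same size misses some vertex of [e]; once
   the vertices outside [e] are fixed, it is one of the test functions of [uniform]. *)
Lemma uniform_hits (L : finType) (e : partial_map J L) (t : seq (partial_map J L))
    x phi eta :
  dep_on (edge_dom e) phi -> uniform nu (edge_dom e) phi eta ->
  (forall e', e' \in t -> [/\ e' != e, (#|edge_dom e'| <= #|edge_dom e|)%nat
     & dep_on (edge_dom e') (c (edge_dom e'))]) ->
  `|pmean (@blowup_family R J X nu L)
      (fun y => phi (pull x e y) * (\prod_(e' <- t) (hit c x e' y)%:R))| <= eta.
Proof.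
move=> phid unif ht; rewrite -(pmean_splice nu_prob e) pmean_exchange.
have bp := blowup_prob nu_prob L.
apply: mean_norm_le; rewrite ?pweight_sum // => y; first exact: pweight_ge0.
pose w (e' : partial_map J L) := [pick i | (i \in edge_dom e) && (e' i != e i)].
have wP e' : e' \in t -> exists2 i, w e' = Some i & (i \in edge_dom e) && (e' i != e i).
  move=> /ht[ne sz _]; rewrite /w; case: pickP => [i hi|no]; first by exists i.
  case/negP: ne; apply/eqP; have sub : edge_dom e \subset edge_dom e'.
    apply/subsetP => i ie; have := no i; rewrite ie /= => /negbFE/eqP e1.
    by move: ie; rewrite !inE e1.
  have ee : edge_dom e = edge_dom e' by apply/eqP; rewrite eqEcard sub sz.
  apply/ffunP => i; have := no i; case: (boolP (i \in edge_dom e)) => /= [_ /negbFE/eqP //|ni _].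
  have := ni; rewrite {1}ee !inE; move: ni; rewrite inE.
  by rewrite !negbK => /eqP -> /eqP ->.
(* Each edge [e'] is charged to one vertex [w e'] at which it differs from [e]; [u i] gathers the
   edges charged to [i], none of which reads [z i]. *)
pose u (i : J) (z : {ffun J -> X}) := all (fun e' : partial_map J L =>
  (w e' == Some i) ==> hit c x e' (splice e y z)) t.
have := unif u; set A := pmean _ _; set B := pmean _ _.
suff -> : B = A.
  apply=> i ie z z' zz; apply: eq_in_all => e' e't; case: eqP => //= we.
  have [_ _ cd] := ht e' e't; rewrite /hit; congr (_ == _); apply: cd => k _.
  rewrite !ffunE; case ek: (e' k) => [l|] //; rewrite !ffunE /=.
  case: eqP => // ekl; apply: zz; rewrite !inE ekl andbT; apply/eqP => ki.
  have [i' we' /andP[_]] := wP e' e't; rewrite we in we'; case: we' => <-.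
  by rewrite -ki ek ekl eqxx.
apply: eq_pmean => // z; congr (_ * _).
  by apply: phid => i; apply: lift_splice.
rewrite prod_bool_seq (prod_bool _ (mem (edge_dom e))); congr (nat_of_bool _)%:R.
apply/allP/forall_inP => [h i ie|h e' e't].
  by apply/allP => e' e't; apply/implyP => _; apply: h.
have [i we /andP[ie _]] := wP e' e't.
by have /allP /(_ e' e't) := h i ie; rewrite we eqxx.
Qed.

Variables (d : {set J} -> {ffun J -> X} -> R) (Bad : {set J} -> {ffun J -> X} -> bool).

Definition edge_prod (L : finType) (H : {set partial_map J L}) x : R :=
  \prod_(e in H) d (edge_dom e) x.

(** The function [d] predicts the conditional probability of each color seen at [x]; the error is
    relative, as the predicted product may be tiny. *)
Definition counts (j N : nat) (tau : R) :=
  forall (L : finType) (H : {set partial_map J L}) x, complex H -> (#|H| <= N)%nat ->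
  (forall e, e \in H -> (#|edge_dom e| <= j)%nat /\ ~~ Bad (edge_dom e) x) ->
  `|pmean (@blowup_family R J X nu L) (pattern_ind R c x H) - edge_prod H x|
    <= tau * edge_prod H x.

Section Step.
Variables (j N : nat) (tau' eps2 : R).
Hypothesis tau'_le1 : tau' <= 1.
Hypothesis IH : counts j (N + N) tau'.
Hypothesis c_dep : forall f : {set J}, (#|f| <= j.+1)%nat -> dep_on f (c f).
Hypothesis d_ge0 : forall (f : {set J}) x, (#|f| <= j.+1)%nat -> ~~ Bad f x -> 0 <= d f x <= 1.
Hypothesis eps2_ge0 : 0 <= eps2.

Variables (L : finType) (H0 : {set partial_map J L}) (x : {ffun J -> X}).
Hypothesis H0_complex : complex H0.
Hypothesis H0_card : (#|H0| <= N)%nat.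
Hypothesis H0_good : forall e, e \in H0 -> (#|edge_dom e| <= j)%nat /\ ~~ Bad (edge_dom e) x.

Lemma counts_upper (L' : finType) (H : {set partial_map J L'}) :
  complex H -> (#|H| <= N + N)%nat ->
  (forall e, e \in H -> (#|edge_dom e| <= j)%nat /\ ~~ Bad (edge_dom e) x) ->
  0 <= edge_prod H x /\
  pmean (@blowup_family R J X nu L') (pattern_ind R c x H) <= 2 * edge_prod H x.
Proof.
move=> cH nH gH; have p0 : 0 <= edge_prod H x.
  apply: prodr_ge0 => e eH; have [dj nb] := gH e eH.
  by have /andP[] := d_ge0 (leqW dj) nb.
split=> //; have := IH cH nH gH; rewrite ler_norml => /andP[_].
have := ler_wpM2r p0 tau'_le1; lra.
Qed.

Variable e : partial_map J L.
Hypothesis e_dom : #|edge_dom e| = j.+1.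
Hypothesis e_faces : forall g : {set J}, g \proper edge_dom e -> restrict e g \in H0.

Let faces : {set partial_map J L} :=
  [set restrict e g | g in [set g : {set J} | g \proper edge_dom e]].

Lemma faces_sub : faces \subset H0.
Proof.
by apply/subsetP => e' /imsetP[g gp ->]; apply: e_faces; move: gp; rewrite inE.
Qed.

Lemma facesP e' :
  reflect (exists2 g : {set J}, g \proper edge_dom e & e' = restrict e g) (e' \in faces).
Proof.
apply: (iffP idP) => [/imsetP[g h ->]|[g h ->]]; last by apply: imset_f; rewrite inE.
by exists g => //; move: h; rewrite inE.
Qed.

Lemma edge_dom_face (g : {set J}) : g \proper edge_dom e -> edge_dom (restrict e g) = g.
Proof. by move=> /proper_sub/setIidPl; rewrite edge_dom_restrict. Qed.

Lemma faces_complex : complex faces.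
Proof.
move=> _ g /facesP[g' gp ->]; apply/facesP; exists (g :&: g').
  by apply: sub_proper_trans gp; apply: subsetIr.
by apply/ffunP => i; rewrite !ffunE !inE; case: (i \in g).
Qed.

Lemma facet_dep : dep_on (edge_dom e) (@facet_ind J R X c (edge_dom e) x).
Proof.
move=> z z' zz; congr (nat_of_bool _)%:R; apply: eq_forallb => g.
case gp: (g \proper edge_dom e) => //=; congr (_ == _).
apply: c_dep => [|i ig].
  by apply: leq_trans (subset_leq_card (proper_sub gp)) _; rewrite e_dom.
by apply: zz; apply: (subsetP (proper_sub gp)).
Qed.

Lemma facet_lift y :
  @facet_ind J R X c (edge_dom e) x (pull x e y) = pattern_ind R c x faces y.
Proof.
have face_hit (g : {set J}) : g \proper edge_dom e ->
    hit c x (restrict e g) y = (c g (pull x e y) == c g x).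
  move=> gp; rewrite /hit edge_dom_face //; congr (_ == _).
  apply: c_dep => [|i ig].
    by apply: leq_trans (subset_leq_card (proper_sub gp)) _; rewrite e_dom.
  by rewrite !ffunE ig.
rewrite pattern_indE; congr (nat_of_bool _)%:R.
apply/forallP/forall_inP => [h e' /facesP[g gp ->]|h g].
  by rewrite face_hit //; have := h g; rewrite gp.
by apply/implyP => gp; rewrite -face_hit //; apply: h; apply/facesP; exists g.
Qed.

Lemma facet_mean :
  pmean nu (@facet_ind J R X c (edge_dom e) x) <= 2 * edge_prod faces x.
Proof.
rewrite -(pmean_lift x (erefl (edge_dom e)) facet_dep).
rewrite (eq_pmean (mu' := @blowup_family R J X nu L) (F' := pattern_ind R c x faces)) //;
  last exact: facet_lift.
apply: (counts_upper faces_complex _ _).2.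
  by apply: leq_trans (subset_leq_card faces_sub) (leq_trans H0_card (leq_addr _ _)).
by move=> e' /(subsetP faces_sub)/H0_good.
Qed.

(** Two copies of [H0] glued along [e]: the right one keeps the vertices of [e] in the [inl] layers
    and moves all others to the [inr] layers. *)
Let left_map := edge_map (fun (i : J) (l : L) => inl l : (L + L)%type).
Let right_map := edge_map (fun (i : J) (l : L) =>
  if e i == Some l then inl l else inr l : (L + L)%type).
Let doubled : {set partial_map J (L + L)%type} := (left_map @: H0) :|: (right_map @: H0).

Lemma left_inj : injective left_map.
Proof. by apply: edge_map_inj => i l l' []. Qed.

Lemma right_inj : injective right_map.
Proof.
apply: edge_map_inj => i l l'.
by case: ifP => _; case: ifP => _ // [].
Qed.

(** The copies share only the vertices of [e], so a common edge is a restriction of [e], and a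
    proper one because edges of [H0] have size at most [j]. *)
Lemma doubled_meet : (left_map @: H0) :&: (right_map @: H0) = left_map @: faces.
Proof.
apply/setP => e'; apply/setIP/imsetP => [[/imsetP[e1 e1H ->] /imsetP[e2 e2H /ffunP e12]]|].
  exists e1 => //; apply/facesP; exists (edge_dom e1).
    have sub : edge_dom e1 \subset edge_dom e.
      apply/subsetP => i; move: (e12 i); rewrite !ffunE !inE.
      case: (e1 i) => [l|] //; case: (e2 i) => [l'|] //=.
      by case: eqP => [->|].
    by rewrite properEcard sub e_dom ltnS; have [] := H0_good e1H.
  apply/ffunP => i; rewrite ffunE inE; move: (e12 i); rewrite !ffunE.
  case: (e1 i) => [l|] //; case: (e2 i) => [l'|] //=.
  by case: eqP => [-> [->]|].
move=> [e1 /facesP[g gp ->] ->]; have h := e_faces gp; rewrite imset_f //; split=> //.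
suff -> : left_map (restrict e g) = right_map (restrict e g) by rewrite imset_f.
apply/ffunP => i; rewrite !ffunE; case: (i \in g) => //.
by case: (e i) => //= l; rewrite eqxx.
Qed.

(** Products over a union and an intersection multiply to the products over the two sets, here two
    copies of [H0] meeting in [faces]. *)
Lemma doubled_prod :
  edge_prod doubled x * edge_prod faces x = edge_prod H0 x ^+ 2.
Proof.
have im (s : J -> L -> (L + L)%type) (H : {set partial_map J L}) :
    injective (edge_map s) -> edge_prod (edge_map s @: H) x = edge_prod H x.
  move=> sI; rewrite /edge_prod big_imset; last by move=> a b _ _; apply: sI.
  by apply: eq_bigr => e' _; rewrite edge_dom_map.
have -> : edge_prod faces x = edge_prod (left_map @: faces) x.
  by rewrite im //; apply: left_inj.
rewrite -doubled_meet /doubled; set A := left_map @: H0; set B := right_map @: H0.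
have -> : edge_prod (A :|: B) x = edge_prod A x * edge_prod (B :\: A) x.
  rewrite /edge_prod (big_setID A) /= setIUl setIid (setUidPl _) ?subsetIr //.
  by rewrite setDUl setDv set0U.
rewrite -mulrA; have -> : edge_prod (B :\: A) x * edge_prod (A :&: B) x = edge_prod B x.
  by rewrite /edge_prod [RHS](big_setID A) /= mulrC setIC.
by rewrite /A /B !im //; [apply: right_inj|apply: left_inj].
Qed.

(** By [pmean_double] the second moment is the probability of the pattern [doubled], whose size
    explains the [N + N] in the induction hypothesis. *)
Lemma codegree_mean :
  pmean nu (fun z => pmean (@blowup_family R J X nu L)
      (fun y => pattern_ind R c x H0 (splice e y z)) ^+ 2)
  <= 2 * edge_prod doubled x.
Proof.
rewrite pmean_double //.
rewrite (eq_pmean (mu' := @blowup_family R J X nu _) (F' := pattern_ind R c x doubled)) //.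
  apply: (counts_upper _ _ _).2.
  - move=> e' g /setUP[] h; apply/setUP; [left|right]; exact: complex_map h.
  - apply: leq_trans (leq_card_setU _ _) _.
    by apply: leq_add; apply: leq_trans (leq_imset_card _ _) H0_card.
  - by move=> e' /setUP[] /imsetP[e1 /H0_good h ->]; rewrite edge_dom_map.
move=> Y; rewrite !pattern_indE -natrM mulnb; congr (nat_of_bool _)%:R.
apply/andP/forall_inP => [[/forall_inP h1 /forall_inP h2] e'|h].
  by case/setUP=> /imsetP[e1 /[dup] /h1 k1 /h2 k2 ->]; rewrite hit_map //.
split; apply/forall_inP => e' e'H.
  by have := h (left_map e'); rewrite hit_map; apply; rewrite inE imset_f.
by have := h (right_map e'); rewrite hit_map; apply; rewrite inE imset_f ?orbT.
Qed.

(* By Cauchy-Schwarz, the second moment of the number of extensions of a cell of [e]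
   to a copy of [H0] counts the pairs of copies glued along [e]. *)
Lemma local_deviation (D : {ffun J -> X} -> R) (B : {ffun J * L -> X} -> R) :
  dep_on (edge_dom e) D -> (forall y, 0 <= B y <= 1) ->
  pmean nu (fun z => D z ^+ 2 * @facet_ind J R X c (edge_dom e) x z)
    <= eps2 ^+ 2 * pmean nu (@facet_ind J R X c (edge_dom e) x) ->
  `|pmean (@blowup_family R J X nu L)
     (fun y => D (pull x e y) * (B y * pattern_ind R c x H0 y))|
  <= 2 * eps2 * edge_prod H0 x.
Proof.
move=> Dd B01 hD; have bp := blowup_prob nu_prob L.
have pi0 y : 0 <= pattern_ind R c x H0 y by rewrite pattern_indE ler0n.
apply: (@le_trans _ _ (pmean (@blowup_family R J X nu L)
     (fun y => `|D (pull x e y)| * pattern_ind R c x H0 y))).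
  apply: le_trans (norm_mean _ _) _ => [y|]; first exact: pweight_ge0.
  apply: le_mean => y; first exact: pweight_ge0.
  have /andP[B0 B1] := B01 y.
  rewrite !normrM (ger0_norm B0) (ger0_norm (pi0 y)) ler_wpM2l //.
  by rewrite ler_piMl.
rewrite -(pmean_splice nu_prob e).
pose Nz z := pmean (@blowup_family R J X nu L) (fun y => pattern_ind R c x H0 (splice e y z)).
pose C := @facet_ind J R X c (edge_dom e) x.
(* The factor [C] is inserted for free, since [H0] contains all proper faces of [e]; it localizes
   [D] to the cell where its second moment is controlled. *)
rewrite (eq_pmean (mu' := nu) (F' := fun z => (`|D z| * C z) * Nz z)) //; last first.
  move=> z; rewrite /Nz /pmean -meanZ; apply: eq_mean => y.
  rewrite -mulrA; congr (_ * _); first by congr `|_|; apply: Dd => i; apply: lift_splice.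
  have -> : C z = C (pull x e (splice e y z)).
    by apply: facet_dep => i /lift_splice ->.
  rewrite /C facet_lift !pattern_indE -natrM mulnb; congr (nat_of_bool _)%:R.
  apply/idP/andP => [h|[]//]; split=> //.
  apply/forall_inP => e' /(subsetP faces_sub); exact: (forall_inP h).
have [p0 _] := counts_upper H0_complex (leq_trans H0_card (leq_addr _ _)) H0_good.
have sq : pmean nu (fun z => (`|D z| * C z) * Nz z) ^+ 2 <= (2 * eps2 * edge_prod H0 x) ^+ 2.
  apply: le_trans (mean_cauchy_schwarz _ _ _) _ => [z|]; first exact: pweight_ge0.
  have -> : mean (pweight nu) (fun z => (`|D z| * C z) ^+ 2) = pmean nu (fun z => D z ^+ 2 * C z).
    apply: eq_mean => z; rewrite exprMn real_normK ?num_real //; congr (_ * _).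
    by rewrite /C /facet_ind; case: [forall g, _]; rewrite ?expr1n ?expr0n.
  have -> : (2 * eps2 * edge_prod H0 x) ^+ 2 =
     (eps2 ^+ 2 * (2 * edge_prod faces x)) * (2 * edge_prod doubled x).
    by rewrite exprMn -doubled_prod; ring.
  apply: ler_pM; last exact: codegree_mean.
  - apply: mean_ge0 => z; first exact: pweight_ge0.
    by rewrite mulr_ge0 ?sqr_ge0 // /C /facet_ind ler0n.
  - apply: mean_ge0 => z; first exact: pweight_ge0.
    by rewrite sqr_ge0.
  - by apply: le_trans hD _; rewrite ler_wpM2l ?sqr_ge0 // facet_mean.
move: sq; rewrite ler_sqr ?nnegrE //.
  apply: mean_ge0 => z; first exact: pweight_ge0.
  rewrite mulr_ge0 ?mulr_ge0 /C /facet_ind ?ler0n //.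
  by apply: mean_ge0 => y; rewrite ?pweight_ge0.
by rewrite !mulr_ge0.
Qed.

End Step.

End Counting.

Lemma le_prod_exp (R : realFieldType) (I : finType) (A : {set I}) (F : I -> R) k N :
  0 <= k <= 1 -> (#|A| <= N)%nat -> (forall i, i \in A -> k <= F i) ->
  k ^+ N <= \prod_(i in A) F i.
Proof.
move=> /andP[k0 k1] AN kF; apply: (@le_trans _ _ (k ^+ #|A|)).
  by apply: ler_wiXn2l.
by rewrite -prodr_const; apply: ler_prod => i iA; rewrite k0 kF.
Qed.

Section CountsStep.
Variables (R : archiRealFieldType) (J X : finType) (nu : J -> X -> R).
Hypothesis nu_prob : prob_family nu.
Variables (c : {set J} -> {ffun J -> X} -> nat) (d : {set J} -> {ffun J -> X} -> R).
Variables (Bad : {set J} -> {ffun J -> X} -> bool).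

(** Edges of size [j.+1] are replaced one at a time by their densities, and the rest is left to the
    induction hypothesis. The bound on [eps2] does not involve [kappa], because the deviation error
    is already proportional to the product over the smaller edges; only [eta] must be small in terms
    of [kappa]. *)
Lemma counts_step (j N : nat) (tau eta eps2 kappa delta : R) :
  0 < tau <= 1 -> 0 <= eps2 -> 0 <= eta -> 0 < kappa <= 1 -> 0 < delta <= 1 ->
  counts nu c d Bad j (N + N) (tau / 2) ->
  (forall f : {set J}, (#|f| <= j.+1)%nat -> dep_on f (c f)) ->
  (forall (f : {set J}) x, (#|f| <= j)%nat -> ~~ Bad f x -> kappa <= d f x <= 1) ->
  (forall (f : {set J}) x, #|f| = j.+1 -> ~~ Bad f x -> delta <= d f x <= 1 /\
     exists gamma, [/\ dep_on f gamma,
       uniform nu f (fun z => color_ind R c f (c f x) z - gamma z) eta &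
       pmean nu (fun z => (gamma z - d f x) ^+ 2 * facet_ind R c f x z)
         <= eps2 ^+ 2 * pmean nu (facet_ind R c f x)]) ->
  N%:R * eta <= tau / 4 * (kappa ^+ N * delta ^+ N) ->
  N%:R * (2 * eps2) <= tau / 4 * delta ^+ N ->
  counts nu c d Bad j.+1 N tau.
Proof.
move=> /andP[tau0 tau1] eps20 eta0 /andP[kappa0 kappa1] /andP[delta0 delta1].
move=> IH cdep dlow dtop Heta Heps L H x cH nH gH.
have t1 : tau / 2 <= 1 by lra.
have d01 (f : {set J}) y : (#|f| <= j.+1)%nat -> ~~ Bad f y -> 0 <= d f y <= 1.
  rewrite leq_eqVlt => /orP[/eqP fj|fj] nb.
    by have [/andP[h ->] _] := dtop f y fj nb; rewrite (le_trans (ltW delta0) h).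
  by have /andP[h ->] := dlow f y fj nb; rewrite (le_trans (ltW kappa0) h).
pose H0 := [set e in H | (#|edge_dom e| <= j)%nat]; pose H1 := H :\: H0.
have H0H : H0 \subset H by apply/subsetP => e; rewrite inE => /andP[].
have H0P e : e \in H0 -> (#|edge_dom e| <= j)%nat /\ ~~ Bad (edge_dom e) x.
  by rewrite inE => /andP[/gH[_ nb] ->].
have H1P e : e \in H1 -> [/\ e \in H, #|edge_dom e| = j.+1 & ~~ Bad (edge_dom e) x].
  rewrite !inE => /andP[h eH]; have [le nb] := gH e eH; split=> //.
  by move: h; rewrite eH /= -ltnNge => gt; apply/eqP; rewrite eqn_leq le gt.
have cH0 : complex H0.
  move=> e g; rewrite !inE => /andP[eH ej]; rewrite cH //= edge_dom_restrict.
  by apply: leq_trans ej; rewrite subset_leq_card // subsetIr.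
have nH0 : (#|H0| <= N)%nat := leq_trans (subset_leq_card H0H) nH.
set p0 := edge_prod d H0 x.
have p00 : kappa ^+ N <= p0.
  apply: le_prod_exp => //; first by rewrite ltW.
  by move=> e /H0P[ej nb]; have /andP[] := dlow _ _ ej nb.
set E := pmean _.
pose B (s : seq (partial_map J L)) (y : {ffun J * L -> X}) : R := \prod_(e <- s) (hit c x e y)%:R.
have hyb s : uniq s -> {subset s <= H1} ->
  `|E (fun y => B s y * pattern_ind R c x H0 y)
     - (\prod_(e <- s) d (edge_dom e) x) * E (pattern_ind R c x H0)|
  <= (size s)%:R * (eta + 2 * eps2 * p0).
  elim: s => [|e s IHs] /=.
    move=> _ _; rewrite big_nil mul1r mul0r.
    have -> : E (fun y => B [::] y * pattern_ind R c x H0 y) = E (pattern_ind R c x H0).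
      by apply: eq_pmean => // y; rewrite /B big_nil mul1r.
    by rewrite subrr normr0.
  move=> /andP[es us] sub.
  have {}IHs := IHs us (fun e' h => sub e' (mem_behead (s := e :: s) h)).
  have [eH ej nb] := H1P e (sub e (mem_head _ _)).
  have [/andP[_ de1] [gamma [gd un dev]]] := dtop _ _ ej nb.
  have /andP[de0 _] := d01 _ _ (eq_leq ej) nb.
  have faces (g : {set J}) : g \proper edge_dom e -> restrict e g \in H0.
    move=> gp; rewrite inE cH //= edge_dom_restrict (setIidPl (proper_sub gp)).
    by rewrite -ltnS -ej proper_card.
  pose phi z := color_ind R c (edge_dom e) (c (edge_dom e) x) z - gamma z.
  pose D z := gamma z - d (edge_dom e) x.
  have A1 : `|E (fun y => phi (pull x e y) *
      (\prod_(e' <- s ++ enum H0) (hit c x e' y)%:R))| <= eta.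
    apply: uniform_hits => //.
      move=> z z' zz; rewrite /phi (gd _ _ zz); congr (_ - _).
      by rewrite /color_ind (cdep _ (eq_leq ej) _ _ zz).
    move=> e'; rewrite mem_cat mem_enum => /orP[e's|e'0].
      have [_ e'j _] := H1P e' (sub e' (mem_behead (s := e :: s) e's)).
      rewrite e'j ej; split=> //; last by apply: cdep; rewrite e'j.
      by apply/eqP => ee; move: es; rewrite -ee e's.
    have [e'j _] := H0P e' e'0; split; [|by rewrite ej leqW|by apply: cdep; rewrite leqW].
    by apply/eqP => ee; move: e'j; rewrite ee ej ltnn.
  have A2 : `|E (fun y => D (pull x e y) * (B s y * pattern_ind R c x H0 y))| <= 2 * eps2 * p0.
    apply: (local_deviation nu_prob t1 IH cdep d01 eps20 cH0 nH0 H0P ej faces) => //.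
      by move=> z z' zz; rewrite /D (gd _ _ zz).
    by move=> y; rewrite /B prod_bool_seq ler0n lern1 leq_b1.
  (* The indicator of [e] is split as (indicator - [gamma]) + ([gamma] - [d]) + [d]: uniformity
     bounds the first part, [local_deviation] the second. *)
  have -> : E (fun y => B (e :: s) y * pattern_ind R c x H0 y) =
     E (fun y => phi (pull x e y) * (\prod_(e' <- s ++ enum H0) (hit c x e' y)%:R))
     + E (fun y => D (pull x e y) * (B s y * pattern_ind R c x H0 y))
     + d (edge_dom e) x * E (fun y => B s y * pattern_ind R c x H0 y).
    rewrite /E /pmean -meanZ -!meanD; apply: eq_mean => y.
    rewrite /B big_cons big_cat /= big_enum /pattern_ind /phi /D.
    have -> : color_ind R c (edge_dom e) (c (edge_dom e) x) (pull x e y) = (hit c x e y)%:R by [].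
    ring.
  rewrite big_cons -natr1; move: A1 A2 IHs.
  set a1 := E _; set a2 := E _; set a3 := E _; set a4 := E _; set pr := \prod_(_ <- _) _.
  move=> A1 A2 A3.
  have -> : a1 + a2 + d (edge_dom e) x * a3 - d (edge_dom e) x * pr * a4 =
     (a1 + a2) + d (edge_dom e) x * (a3 - pr * a4) by ring.
  apply: le_trans (ler_normD _ _) _; rewrite normrM (ger0_norm de0).
  have := ler_normD a1 a2; have := ler_piMl (normr_ge0 (a3 - pr * a4)) de1.
  lra.
have uH1 : {subset enum H1 <= H1} by move=> e; rewrite mem_enum.
have {hyb} := hyb (enum H1) (enum_uniq _) uH1.
have -> : E (fun y => B (enum H1) y * pattern_ind R c x H0 y) = E (pattern_ind R c x H).
  apply: eq_pmean => // y; rewrite /B /pattern_ind [RHS](big_setID H0) /= big_enum /=.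
  by rewrite (setIidPr H0H) mulrC.
have := IH L H0 x cH0 (leq_trans nH0 (leq_addr _ _)) H0P.
rewrite -/E -/p0 big_enum /= -cardE.
have -> : edge_prod d H x = p0 * \prod_(e in H1) d (edge_dom e) x.
  by rewrite /edge_prod (big_setID H0) /= (setIidPr H0H).
set p1 := \prod_(e in H1) _; set a := E _; set b := E _ => Hb Ha.
have nH1 : (#|H1| <= N)%nat := leq_trans (subset_leq_card (subsetDl _ _)) nH.
have p10 : delta ^+ N <= p1.
  apply: le_prod_exp => //; first by rewrite ltW.
  by move=> e /H1P[_ ej nb]; have [/andP[]] := dtop _ _ ej nb.
have kN : 0 < kappa ^+ N by rewrite exprn_gt0.
have dN : 0 < delta ^+ N by rewrite exprn_gt0.
have p0g : 0 < p0 := lt_le_trans kN p00.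
have p1g : 0 < p1 := lt_le_trans dN p10.
have pp : kappa ^+ N * delta ^+ N <= p0 * p1 by rewrite ler_pM // ltW.
have q1 : p1 * p0 <= p1 * p0 by [].
have e1 : (#|H1|)%:R * (eta + 2 * eps2 * p0) <= tau / 2 * (p0 * p1).
  apply: (@le_trans _ _ (N%:R * (eta + 2 * eps2 * p0))).
    by rewrite ler_wpM2r ?ler_nat // addr_ge0 // !mulr_ge0 // ltW.
  have h1 : tau / 4 * (kappa ^+ N * delta ^+ N) <= tau / 4 * (p0 * p1).
    by rewrite ler_wpM2l // divr_ge0 // ltW.
  have h2 : N%:R * (2 * eps2) * p0 <= tau / 4 * p1 * p0.
    rewrite ler_wpM2r ?(ltW p0g) //; apply: le_trans Heps _.
    by rewrite ler_wpM2l // divr_ge0 // ltW.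
  lra.
have e2 : `|p1 * (a - p0)| <= p1 * (tau / 2 * p0).
  by rewrite normrM (gtr0_norm p1g) ler_wpM2l // ltW.
have -> : b - p0 * p1 = (b - p1 * a) + p1 * (a - p0) by ring.
apply: le_trans (ler_normD _ _) _; lra.
Qed.

End CountsStep.

(** * Removal lemma *)

Section BadSets.
Variables (R : archiRealFieldType) (J X : finType) (nu : J -> X -> R).
Hypothesis nu_prob : prob_family nu.

Lemma eq_counts (c c' : {set J} -> {ffun J -> X} -> nat)
    (d d' : {set J} -> {ffun J -> X} -> R) (Bad Bad' : {set J} -> {ffun J -> X} -> bool)
    j N tau :
  (forall f : {set J}, (#|f| <= j)%nat -> [/\ c f = c' f, d f = d' f & Bad f = Bad' f]) ->
  counts nu c' d' Bad' j N tau -> counts nu c d Bad j N tau.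
Proof.
move=> ext cnt L H x cH nH gH.
have -> : edge_prod d H x = edge_prod d' H x.
  by apply: eq_bigr => e /gH[ej _]; have [_ -> _] := ext _ ej.
have -> : pmean (blowup_family nu (L:=L)) (pattern_ind R c x H)
    = pmean (blowup_family nu (L:=L)) (pattern_ind R c' x H).
  apply: eq_pmean => // y; apply: eq_bigr => e /gH[ej _].
  by rewrite /hit; have [-> _ _] := ext _ ej.
apply: cnt => // e eH; have [ej nb] := gH e eH; split=> //.
by have [_ _ <-] := ext _ ej.
Qed.

Lemma pmean_sum_colors (m : nat) (a : {ffun J -> X} -> nat)
    (F : nat -> {ffun J -> X} -> R) :
  (forall x, (a x < m)%nat) ->
  pmean nu (fun x => F (a x) x)
  = \sum_(i < m) pmean nu (fun x => (a x == i :> nat)%:R * F i x).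
Proof.
move=> am; rewrite -[RHS]mean_sum; apply: eq_mean => x.
rewrite (bigD1 (Ordinal (am x))) //= eqxx mul1r big1 ?addr0 // => i ni.
have /negPf -> : a x != i by apply: contraNneq ni => e; apply/eqP/val_inj.
by rewrite mul0r.
Qed.

(** Within a cell each rare color takes a share below [delta], and there are at most [m] colors. *)
Lemma low_density_mean (j m : nat) p c (f : {set J}) delta :
  coloring j m c -> #|f| = j -> 0 <= delta ->
  pmean nu (fun x => (density nu p c f (c f x) x < delta)%O%:R) <= m%:R * delta.
Proof.
move=> cc fj delta0; have [_ cm] := cc f fj.
rewrite (pmean_sum_colors (fun a x => (density nu p c f a x < delta)%O%:R) cm).
rewrite mulr_natl -[m in leRHS]card_ord -sumr_const; apply: ler_sum => i _.
rewrite -/(color_ind R c f i) /pmean.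
(* Being rare depends on the cell only, so the indicator of the color may be replaced by its
   density. *)
rewrite -(mean_cmean (fun x => pweight_ge0 x nu_prob) (key := face_colors p f)); last first.
  by move=> x y e; rewrite /density (cmean_key _ _ e).
rewrite -/(density nu p c f i); apply: le_trans (ler_norm _) _.
apply: mean_norm_le; rewrite ?pweight_sum // => x; first exact: pweight_ge0.
have d0 := density_ge0 p c f i x nu_prob.
by case: ltP => h; rewrite ?mulr1 ?mulr0 ?normr0 // ger0_norm // ltW.
Qed.

(** Markov's inequality for the conditional mean of [D ^+ 2] on the cells of [key]; in the
    multiplied form the strict inequality fails on cells of weight zero. *)
Lemma deviation_mean (K : eqType) (key : {ffun J -> X} -> K) (D : {ffun J -> X} -> R) e :
  0 < e ->
  pmean nu (fun x => (e * pmean nu (fun z => (key z == key x)%:R)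
     < pmean nu (fun z => D z ^+ 2 * (key z == key x)%:R))%O%:R)
  <= pmean nu (fun z => D z ^+ 2) / e.
Proof.
move=> e0; have w0 x : 0 <= pweight nu x by apply: pweight_ge0.
rewrite ler_pdivlMr // mulrC /pmean -meanZ.
have -> : mean (pweight nu) (fun z => D z ^+ 2) =
   mean (pweight nu) (cmean (pweight nu) key (fun z => D z ^+ 2)).
  transitivity (mean (pweight nu) (fun z => D z ^+ 2 * 1)).
    by apply: eq_mean => z; rewrite mulr1.
  by rewrite -(mean_cmean w0 (key := key)) //; apply: eq_mean => z; rewrite mulr1.
apply: le_mean => // x; rewrite /cmean.
set P := mean _ (fun y => (key y == key x)%:R).
have -> : mean (pweight nu) (fun z => D z ^+ 2 * (key z == key x)%:R)
   = mean (pweight nu) (fun z => (key z == key x)%:R * D z ^+ 2).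
  by apply: eq_mean => z; rewrite mulrC.
set Q := mean _ (fun y => _ * D y ^+ 2).
have P0 : 0 <= P by apply: mean_ge0 => // z; rewrite ler0n.
have Q0 : 0 <= Q by apply: mean_ge0 => // z; rewrite mulr_ge0 ?sqr_ge0 ?ler0n.
case: ltP => h; last by rewrite mulr0 divr_ge0.
rewrite mulr1; have [Pz|nz] := eqVneq P 0; last first.
  by rewrite ler_pdivlMr ?lt_def ?nz // ltW.
move: h; rewrite Pz mulr0 ltNge => /negP[]; rewrite /Q /mean big1 // => z _.
have [wz|wz] := eqVneq (pweight nu z) 0; first by rewrite wz mul0r.
have [kz|_] := eqVneq (key z) (key x); last by rewrite mul0r mulr0.
move/eqP: wz; case; apply/eqP; rewrite eq_le w0 andbT -Pz /P /mean (bigD1 z) //= kz eqxx mulr1.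
by rewrite lerDl; apply: sumr_ge0 => y _; rewrite mulr_ge0 // ler0n.
Qed.

Definition lower_colors (c : {set J} -> {ffun J -> X} -> nat) (f : {set J}) x :
  {ffun {set J} -> nat} := [ffun g : {set J} => if g \proper f then c g x else 0%nat].

Lemma facet_indE c (f : {set J}) x z :
  facet_ind R c f x z = (lower_colors c f z == lower_colors c f x)%:R.
Proof.
congr (nat_of_bool _)%:R; apply/forallP/eqP => [h|/ffunP h g].
  by apply/ffunP => g; rewrite !ffunE; have := h g; case: (g \proper f) => //= /eqP.
by apply/implyP => gf; have := h g; rewrite !ffunE gf => ->.
Qed.

End BadSets.

Lemma common_lower_bound (R : realFieldType) (K : nat -> R) M :
  (forall i, 0 < K i) -> exists k, 0 < k /\ forall i, (i <= M)%nat -> k <= K i.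
Proof.
move=> K0; elim: M => [|M [k [k0 kK]]].
  by exists (K 0%nat); split=> // i; rewrite leqn0 => /eqP ->.
exists (Order.min k (K M.+1)); split=> [|i]; first by rewrite lt_min k0 K0.
by rewrite leq_eqVlt ltnS ge_min => /orP[/eqP ->|/kK ->]; rewrite ?lexx ?orbT.
Qed.

(** Induction on [j]: the coarse coloring [p] of the [j]-sets takes the place of [c0]. The constants
    [delta], [eps2] and [epsr] are fixed before the number of colors of [p] is known; only the
    uniformity error [Phi] may depend on it. *)
Theorem counting_regularity (R : archiRealFieldType) (J : finType) (j m N : nat)
    (eps tau : R) : 0 < eps -> 0 < tau <= 1 ->
  exists kappa : R, 0 < kappa <= 1 /\
  forall (X : finType) (nu : J -> X -> R) c0, prob_family nu -> coloring j m c0 ->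
  exists c (d : {set J} -> {ffun J -> X} -> R) (Bad : {set J} -> {ffun J -> X} -> bool),
  [/\ forall f : {set J}, #|f| = j -> c f = c0 f,
    forall f : {set J}, (#|f| <= j)%nat -> [/\ dep_on f (c f), dep_on f (Bad f) &
       pmean nu (fun x => (Bad f x)%:R) <= eps],
    forall (f : {set J}) x, (#|f| <= j)%nat -> ~~ Bad f x -> kappa <= d f x <= 1 &
    counts nu c d Bad j N tau].
Proof.
elim: j m N eps tau => [|j IH] m N eps tau eps0 /andP[tau0 tau1].
  (* A coloring of the empty set is constant, so every pattern has probability 1. *)
  exists 1; rewrite ltr01 lexx; split=> // X nu c0 np cc.
  exists c0, (fun _ _ => 1), (fun _ _ => false); split=> //.
  - move=> f; rewrite leqn0 => /eqP f0; have [dp _] := cc f f0; split=> //.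
    by rewrite pmean_cst // ltW.
  - by move=> f x _ _; rewrite lexx.
  - move=> L H x cH nH gH; rewrite /edge_prod big1 // mulr1.
    rewrite (@eq_pmean _ _ _ _ (blowup_family nu (L:=L)) _ (fun=> 1)) //.
      by rewrite pmean_cst ?subrr ?normr0 ?ltW //; apply: blowup_prob.
    move=> y; rewrite /pattern_ind big1 // => e /gH[]; rewrite leqn0 => /eqP e0 _.
    have [dp _] := cc _ e0; rewrite /hit (dp _ x) ?eqxx // => i.
    by rewrite (cards0_eq e0) inE.
pose eps' := Order.min eps 1.
have eps'0 : 0 < eps' by rewrite lt_min eps0 ltr01.
have eps'1 : eps' <= 1 by rewrite ge_min lexx orbT.
have eps'e : eps' <= eps by rewrite ge_min lexx.
have m0 : 0 < m.+1%:R :> R by rewrite ltr0n.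
have N0 : 0 < N.+1%:R :> R by rewrite ltr0n.
(* Rare colors cost at most [m * delta], half of [eps']; the cap of [eps'] at 1 gives
   [delta <= 1]. *)
pose delta := eps' / (2 * m.+1%:R).
have mlt : m%:R <= m.+1%:R :> R by rewrite ler_nat.
have m1 : 1 <= m.+1%:R :> R by rewrite ler1n.
have delta0 : 0 < delta by rewrite divr_gt0 // mulr_gt0.
have delta1 : delta <= 1 by rewrite ler_pdivrMr ?mulr_gt0 // mul1r; lra.
have deltam : m%:R * delta <= eps' / 2.
  have -> : eps' / 2 = m.+1%:R * delta.
    by move: m0; rewrite /delta; move: (m.+1%:R) => q q0; field; rewrite gt_eqF.
  by rewrite ler_wpM2r // ltW.
have dN : 0 < delta ^+ N by rewrite exprn_gt0.
pose eps2 := tau / 4 * delta ^+ N / (2 * N.+1%:R).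
have eps20 : 0 < eps2 by apply: divr_gt0; apply: mulr_gt0 => //; apply: divr_gt0.
(* Markov's inequality with threshold [eps2 ^+ 2], summed over [m] colors, then costs the other half
   of [eps']. *)
pose epsr := eps' * eps2 ^+ 2 / (2 * m.+1%:R).
have epsr0 : 0 < epsr by apply: divr_gt0; apply: mulr_gt0 => //; apply: exprn_gt0.
have tau2 : 0 < tau / 2 <= 1 by apply/andP; split; lra.
(* [K m'] is the density bound for a coarse coloring with [m'] colors; it is needed as a function in
   order to define [Phi]. *)
have [K hK] := boolp.choice (fun m' => IH m' (N + N)%nat eps (tau / 2) eps0 tau2).
have K01 i : 0 < K i <= 1 := (hK i).1.
have K0 i : 0 < K i by have /andP[] := K01 i.
pose Phi i := tau / 4 * (K i ^+ N * delta ^+ N) / N.+1%:R.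
have Phi0 i : 0 < Phi i.
  by apply: divr_gt0 => //; rewrite mulr_gt0 ?divr_gt0 // mulr_gt0 ?exprn_gt0.
have [M hM] := regularity J j m epsr0 Phi0.
have [k [k0 kK]] := common_lower_bound M K0.
exists (Order.min k delta); split.
  by rewrite lt_min k0 delta0 ge_min delta1 orbT.
move=> X nu c0 np cc.
have [m' [p [ga [m'M pc reg]]]] := hM X nu c0 np cc.
have [_ /(_ X nu p np pc)[c' [d' [Bad' [c'p c'B d'b cnt]]]]] := hK m'.
pose top (f : {set J}) := #|f| == j.+1.
pose c f := if top f then c0 f else c' f.
pose d f := if top f then (fun x => density nu p c0 f (c0 f x) x) else d' f.
pose dev f x := pmean nu (fun z => (ga f (c0 f x) z - d f x) ^+ 2 * facet_ind R c f x z).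
(* A top set is bad if its color is rare, or if the fine density strays from the coarse one in mean
   square on the cell of lower colors. *)
pose Bad f := if top f then (fun x => (d f x < delta) ||
   (eps2 ^+ 2 * pmean nu (facet_ind R c f x) < dev f x)) else Bad' f.
have ntop (f : {set J}) : (#|f| <= j)%nat -> top f = false.
  by move=> fj; apply/negbTE; rewrite /top neq_ltn ltnS fj.
have low (f : {set J}) : (#|f| <= j)%nat -> [/\ c f = c' f, d f = d' f & Bad f = Bad' f].
  by move=> /ntop fj; rewrite /c /d /Bad fj.
have cdep (f : {set J}) : (#|f| <= j.+1)%nat -> dep_on f (c f).
  rewrite leq_eqVlt ltnS => /orP[ft|fj].
    by rewrite /c /top ft; have [] := cc f (eqP ft).
  by have [-> _ _] := low f fj; have [] := c'B f fj.
have facet_face (f g : {set J}) : top f -> g \proper f -> (#|g| <= j)%nat.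
  by move=> /eqP fj /proper_card; rewrite fj ltnS.
(* Cells of all lower colors refine cells of facet colors, so the coarse density is constant on
   them. *)
have cover (f : {set J}) x z : top f -> facet_ind R c f x z != 0 ->
    face_colors p f z = face_colors p f x.
  move=> ft; rewrite /facet_ind pnatr_eq0 eqb0 negbK => /forallP h.
  apply/face_colors_inj => v vf.
  have gj : #|f :\ v| = j by move/eqP: ft; rewrite (cardsD1 v) vf => -[].
  have gp : f :\ v \proper f by rewrite properD1.
  have := h (f :\ v); rewrite gp /= /c ntop ?gj // c'p // => /eqP //.
exists c, d, Bad; split.
- by move=> f fj; rewrite /c /top fj eqxx.
- move=> f; rewrite leq_eqVlt ltnS => /orP[ft|fj]; last first.
    by have [-> _ ->] := low f fj; apply: c'B.
  have fj := eqP ft; have [c0d c0m] := cc f fj; split.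
  + by apply: cdep; rewrite fj.
  + move=> x y xy; rewrite /Bad /top ft.
    have dE : d f x = d f y.
      rewrite /d /top ft (c0d _ _ xy); apply: cmean_key.
      exact: (face_colors_dep pc fj).
    have fE : facet_ind R c f x = facet_ind R c f y.
      apply/boolp.funext => z; congr (nat_of_bool _)%:R; apply: eq_forallb => g.
      case gf: (g \proper f) => //=; congr (_ == _); apply: cdep => [|i ig].
        by apply: leqW; apply: facet_face gf.
      by apply: xy; apply: (subsetP (proper_sub gf)).
    by rewrite /dev dE fE (c0d _ _ xy).
  + apply: (@le_trans _ _ (pmean nu (fun x => (density nu p c0 f (c0 f x) x < delta)%O%:R)
       + pmean nu (fun x => (eps2 ^+ 2 * pmean nu (facet_ind R c f x) < dev f x)%O%:R))).
      rewrite /pmean -meanD; apply: le_mean => x; first exact: pweight_ge0.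
      rewrite /Bad /d /top ft.
      by case: (_ < delta); case: (_ < dev f x); rewrite /= ?addr0 ?add0r ?lexx // lerDl.
    suff : pmean nu (fun x =>
        (eps2 ^+ 2 * pmean nu (facet_ind R c f x) < dev f x)%O%:R) <= eps' / 2.
      have := low_density_mean np p cc fj (ltW delta0); lra.
    pose D (a : nat) z := ga f a z - density nu p c0 f a z.
    (* With the color [a] frozen, [D a] no longer depends on [x] and [deviation_mean] applies. *)
    pose S a x : R := (eps2 ^+ 2 * pmean nu (fun z => (lower_colors c f z == lower_colors c f x)%:R)
      < pmean nu (fun z => D a z ^+ 2 * (lower_colors c f z == lower_colors c f x)%:R))%O%:R.
    have -> : pmean nu (fun x => (eps2 ^+ 2 * pmean nu (facet_ind R c f x) < dev f x)%O%:R)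
       = pmean nu (fun x => S (c0 f x) x).
      apply: eq_pmean => // x; congr (nat_of_bool (_ * _ < _))%:R.
        by apply: eq_pmean => // z; apply: facet_indE.
      apply: eq_pmean => // z; rewrite -(facet_indE R).
      have [->|nz] := eqVneq (facet_ind R c f x z) 0; first by rewrite !mulr0.
      by rewrite /D /d /top ft /density (cmean_key _ _ (cover f x z ft nz)).
    rewrite (pmean_sum_colors nu S c0m).
    apply: (@le_trans _ _ (\sum_(i < m) epsr / eps2 ^+ 2)); last first.
      rewrite sumr_const card_ord -[leLHS]mulr_natl.
      have -> : epsr / eps2 ^+ 2 = delta.
        by move: m0; rewrite /epsr /delta; move: (m.+1%:R) => q q0; field; rewrite !gt_eqF.
      exact: deltam.
    apply: ler_sum => i _; have [_ Di _] := reg f i fj (ltn_ord i).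
    apply: (@le_trans _ _ (pmean nu (S i))).
      apply: le_mean => x; first exact: pweight_ge0.
      by rewrite ler_piMl ?lern1 ?leq_b1 // /S ler0n.
    apply: le_trans (deviation_mean np _ _ _) _; first by rewrite exprn_gt0.
    by rewrite ler_wpM2r // invr_ge0 sqr_ge0.
- move=> f x; rewrite leq_eqVlt ltnS => /orP[ft|fj].
    rewrite /Bad /d /top ft negb_or -leNgt => /andP[h _].
    by rewrite density_le1 // andbT ge_min h orbT.
  have [_ -> ->] := low f fj => nb; have /andP[h ->] := d'b f x fj nb.
  by rewrite andbT ge_min (le_trans (kK _ m'M) h).
- apply: (@counts_step R J X nu np c d Bad j N tau (Phi m') eps2 (K m') delta) => //.
  + by rewrite tau0.
  + exact: ltW.
  + exact: ltW.
  + by rewrite delta0.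
  + exact: eq_counts cnt.
  + by move=> f x fj; have [_ -> ->] := low f fj; apply: d'b.
  + move=> f x fj; have ft : top f by rewrite /top fj.
    rewrite /Bad ft negb_or -!leNgt => /andP[h1 h2].
    split; first by rewrite h1 /d ft density_le1.
    have [_ c0m] := cc f fj; have [gd _ un] := reg f (c0 f x) fj (c0m x).
    exists (ga f (c0 f x)); split=> //.
    by rewrite /color_ind /c ft.
  + rewrite /Phi mulrA ler_pdivrMr // mulrC ler_wpM2l ?ler_nat //.
    by rewrite ltW // mulr_gt0 ?divr_gt0 // mulr_gt0 ?exprn_gt0.
  + have -> : N%:R * (2 * eps2) = N%:R * (tau / 4 * delta ^+ N) / N.+1%:R.
      by move: N0; rewrite /eps2; move: (N.+1%:R) => q q0; field; rewrite gt_eqF.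
    rewrite ler_pdivrMr // mulrC ler_wpM2l ?ler_nat //.
    by rewrite ltW // mulr_gt0 ?divr_gt0.
Qed.

Theorem partite_removal (R : archiRealFieldType) (J : finType) (k : nat) (eps : R) :
  0 < eps -> exists c : R, 0 < c <= 1 /\
  forall (X : finType) (nu : J -> X -> R), prob_family nu ->
  forall (E : {set {set J}}) (A : {set J} -> {ffun J -> X} -> bool),
  (forall e : {set J}, e \in E -> #|e| = k /\ dep_on e (A e)) ->
  c <= pmean nu (fun x => [forall e in E, A e x]%:R) \/
  exists D : {set J} -> {ffun J -> X} -> bool,
    (forall e : {set J}, e \in E -> dep_on e (D e) /\ pmean nu (fun x => (D e x)%:R) <= eps) /\
    forall x, (forall e, e \in E -> A e x) -> exists2 e, e \in E & D e x.
Proof.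
move=> eps0; set n := #|{set J}|.
have n0 : 0 < n%:R :> R by rewrite ltr0n /n; apply/card_gt0P; exists set0.
pose N := #|{: partial_map J unit}|.
have half : 0 < (2^-1 : R) <= 1 by apply/andP; split; lra.
have [k0 [/andP[k00 k01] reg]] :=
  @counting_regularity R J k 2 N (eps / n%:R) 2^-1 (divr_gt0 eps0 n0) half.
have kN : 0 < k0 ^+ N by rewrite exprn_gt0.
exists (2^-1 * k0 ^+ N); split.
  have kN1 : k0 ^+ N <= 1 by rewrite exprn_ile1 // ltW.
  by apply/andP; split; lra.
move=> X nu np E A hA.
(* Membership in [A e] serves as a coloring with two colors. *)
pose c0 e x : nat := if e \in E then A e x else false.
have cc : coloring k 2 c0.
  move=> e ek; split=> [x y xy|x]; rewrite /c0; last first.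
    by case: (e \in E) => //; case: (A e x).
  by case eE: (e \in E) => //; have [_ dp] := hA e eE; rewrite (dp x y).
have [c [d [Bad [ck cB db cnt]]]] := reg X nu c0 np cc.
(* An edge is removed when it or a face of it is bad; a union bound over at most [n] faces explains
   [eps / n]. *)
pose D (e : {set J}) x := [exists f : {set J}, (f \subset e) && Bad f x].
have sub_card (e f : {set J}) : e \in E -> f \subset e -> (#|f| <= k)%nat.
  by move=> /hA[<- _]; apply: subset_leq_card.
have [good|nogood] := boolp.EM (exists x, forall e, e \in E -> A e x && ~~ D e x); last first.
  right; exists D; split=> [e eE|x Ax]; last first.
    have /boolp.existsNP[e /boolp.not_implyP[eE]] : ~ forall e, e \in E -> A e x && ~~ D e x.
      by move=> h; apply: nogood; exists x.
    by rewrite Ax //= => /negP; rewrite negbK; exists e.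
  split=> [x y xy|].
    apply: eq_existsb => f; case fe: (f \subset e) => //=.
    have [_ Bd _] := cB f (sub_card e f eE fe).
    by apply: Bd => i /(subsetP fe); apply: xy.
  apply: (@le_trans _ _ (pmean nu (fun x => \sum_(f : {set J} | f \subset e) (Bad f x)%:R))).
    apply: le_mean => x; first exact: pweight_ge0.
    rewrite /D; case: existsP => [[f /andP[fe Bf]]|_]; last by apply: sumr_ge0.
    by rewrite (bigD1 f) //= Bf lerDl sumr_ge0.
  rewrite /pmean mean_sum; apply: (@le_trans _ _ (\sum_(f : {set J} | f \subset e) eps / n%:R)).
    by apply: ler_sum => f fe; have [_ _] := cB f (sub_card e f eE fe).
  rewrite big_mkcond /=; apply: (@le_trans _ _ (\sum_(f : {set J}) eps / n%:R)).
    by apply: ler_sum => f _; case: ifP => // _; rewrite divr_ge0 // ltW.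
  by rewrite sumr_const -/n -[leLHS]mulr_natr divfK ?gt_eqF.
left; have [x hx] := good.
pose full : partial_map J unit := [ffun=> Some tt].
have full_dom : edge_dom full = setT by apply/setP => i; rewrite !inE ffunE.
have dom_r g : edge_dom (restrict full g) = g by rewrite edge_dom_restrict full_dom setIT.
(* The pattern consists of all faces of edges in [E]; one layer suffices, and [N] bounds the size of
   any such pattern. *)
pose H : {set partial_map J unit} :=
  [set restrict full g | g in [set g : {set J} | [exists e in E, g \subset e]]].
have HP e' : e' \in H -> exists g e : {set J}, [/\ e \in E, g \subset e & e' = restrict full g].
  by move=> /imsetP[g]; rewrite inE => /exists_inP[e eE ge] ->; exists g, e.
have cH : complex H.
  move=> e' g' /HP[g [e [eE ge ->]]]; apply/imsetP; exists (g' :&: g).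
    rewrite inE; apply/exists_inP; exists e => //; apply: subset_trans ge; exact: subsetIr.
  by apply/ffunP => i; rewrite !ffunE !inE; case: (i \in g').
have gH e' : e' \in H -> (#|edge_dom e'| <= k)%nat /\ ~~ Bad (edge_dom e') x.
  move=> /HP[g [e [eE ge ->]]]; rewrite dom_r; split; first exact: sub_card eE ge.
  have /andP[_] := hx e eE; rewrite negb_exists => /forallP /(_ g); by rewrite ge.
have := cnt _ H x cH (max_card _) gH.
set p := edge_prod d H x => bnd.
have pk : k0 ^+ N <= p.
  apply: le_prod_exp; rewrite ?max_card ?(ltW k00) //.
  by move=> e' /gH[ek nb]; have /andP[] := db _ _ ek nb.
apply: (@le_trans _ _ (pmean (blowup_family nu (L:=unit)) (pattern_ind R c x H))).
  move: bnd; rewrite ler_norml => /andP[]; lra.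
rewrite -(pmean_lift np x full_dom (F := fun x => [forall e in E, A e x]%:R)); last first.
  by move=> y z yz; have -> : y = z by apply/ffunP => i; apply: yz.
apply: le_mean => y; first by apply: pweight_ge0; apply: blowup_prob.
rewrite pattern_indE ler_nat; case: forall_inP => // h.
have -> // : [forall e in E, A e (pull x full y)].
apply/forall_inP => e eE; have [ek Ad] := hA e eE.
have eH : restrict full e \in H.
  by apply: imset_f; rewrite inE; apply/exists_inP; exists e.
(* The color of [e] still records [A e], which holds at [x], so every copy of the pattern lies in
   [A e]. *)
have := h _ eH; rewrite /hit dom_r ck // /c0 eE.
have /andP[-> _] := hx e eE.
have -> : A e (pull x (restrict full e) y) = A e (pull x full y).
  by apply: Ad => i ie; rewrite !ffunE ie.
by case: (A e _).
Qed.

(** * Colored graphs on probability spaces *)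

Lemma unused_color (f : nat -> nat) (n b : nat) : (n < b)%nat ->
  exists c, (c < b)%nat /\ forall a, (a < n)%nat -> f a <> c.
Proof.
move=> nb; pose s := [seq f a | a <- seq.iota 0 n].
have [/allP sub|/allPn[c cb cs]] := boolP (all (mem s) (seq.iota 0 b)).
  by have := uniq_leq_size (iota_uniq 0%nat b) sub; rewrite size_map !size_iota leqNgt nb.
exists c; split=> [|a an e]; first by move: cb; rewrite mem_iota.
by case/negP: cs; rewrite /= -e map_f // mem_iota.
Qed.

Section TaggedFamily.
Variables (r : nat) (T : 'I_r -> finType) (mu : forall i, T i -> R).
Hypothesis mu_prob : forall i, is_prob_space (@mu i).

(* All parts share the alphabet [{i : 'I_r & T i}]; letters of another part have weight 0. *)
Definition tagged_family (V : finType) (s : V -> 'I_r) (v : V) (t : {i : 'I_r & T i}) : R :=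
  if tag t == s v then mu (tagged t) else 0.

Lemma tagged_family_prob (V : finType) (s : V -> 'I_r) : prob_family (tagged_family s).
Proof.
split=> v => [t|]; rewrite /tagged_family.
  by case: ifP => // _; have [mu0 _] := mu_prob (tag t).
rewrite -big_mkcond /=; have [_ <-] := mu_prob (s v).
transitivity (\sum_(i | i == s v) \sum_(x : T i) mu x); last by rewrite big_pred1_eq.
rewrite (sig_big_dep _ (fun i (x : T i) => true)) /=.
by apply: eq_bigl => t; rewrite andbT.
Qed.

Lemma prob_space_inhabited i : T i.
Proof.
case: (pickP (fun _ : T i => true)) => [x _|no]; first exact: x.
exfalso; have [_] := mu_prob i; rewrite big1 => [|x _]; last by have := no x.
by move/eqP; rewrite eq_sym oner_eq0.
Qed.

Definition untag_at i (t : {i : 'I_r & T i}) : T i :=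
  tagged_as (Tagged T (prob_space_inhabited i)) t.

Lemma untag_at_tagged i (x : T i) : untag_at i (Tagged T x) = x.
Proof. exact: (@tagged_asE _ T (Tagged T (prob_space_inhabited i)) x). Qed.

Lemma tagged_untag_at i (t : {i : 'I_r & T i}) : tag t = i -> Tagged T (untag_at i t) = t.
Proof. by case: t => j x /= e; case: i / e; rewrite untag_at_tagged. Qed.

(** Points with a wrong tag have weight zero, and [theta] parametrizes the others. *)
Lemma pmean_tagged (V Phi : finType) (s : V -> 'I_r)
    (theta : Phi -> {ffun V -> {i : 'I_r & T i}}) theta' F :
  cancel theta theta' -> (forall phi v, tag (theta phi v) = s v) ->
  (forall x : {ffun V -> {i : 'I_r & T i}}, (forall v, tag (x v) = s v) ->
     theta (theta' x) = x) ->
  pmean (tagged_family s) F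
  = \sum_phi (\prod_v mu (tagged (theta phi v))) * F (theta phi).
Proof.
move=> thetaK thetaT theta'K; rewrite /pmean /mean.
rewrite (bigID (fun x : {ffun V -> {i : 'I_r & T i}} => [forall v, tag (x v) == s v])) /=.
rewrite [X in _ + X]big1 ?addr0; last first.
  move=> x; rewrite negb_forall => /existsP[v /negPf ne].
  by rewrite /pweight (bigD1 v) //= /tagged_family ne !mul0r.
rewrite (reindex_onto theta theta') /=; last first.
  by move=> x /forallP h; apply: theta'K => v; apply/eqP.
apply: eq_big => [phi|phi _].
  by rewrite thetaK eqxx andbT; apply/forallP => v; rewrite thetaT.
congr (_ * _); apply: eq_bigr => v _; rewrite /tagged_family.
by have /eqP -> := thetaT phi v.
Qed.

Lemma pmean_vtuple F :
  pmean (tagged_family id) F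
  = \sum_(t : vtuple T) edge_weight mu t * F [ffun i => Tagged T (t i)].
Proof.
pose theta (t : vtuple T) : {ffun 'I_r -> {i : 'I_r & T i}} := [ffun i => Tagged T (t i)].
pose theta' (x : {ffun 'I_r -> {i : 'I_r & T i}}) : vtuple T :=
  @finfun 'I_r (fun i => T i) (fun i => untag_at i (x i)).
rewrite (@pmean_tagged _ _ id theta theta').
- apply: eq_bigr => t _; congr (_ * _); apply: eq_bigr => i _; by rewrite ffunE.
- by move=> t; apply/ffunP => i; rewrite !ffunE untag_at_tagged.
- by move=> t i; rewrite ffunE.
- by move=> x xt; apply/ffunP => i; rewrite !ffunE tagged_untag_at.
Qed.

Definition tagged_map (h : nat) (phi : Defs.pmap h T) : {ffun 'I_r * 'I_h -> {i : 'I_r & T i}} :=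
  [ffun p => Tagged T (phi p.1 p.2)].

Lemma pmean_pmap (h : nat) F :
  pmean (tagged_family (@fst 'I_r 'I_h)) F
  = \sum_(phi : Defs.pmap h T) map_weight mu phi * F (tagged_map phi).
Proof.
pose theta' (x : {ffun 'I_r * 'I_h -> {i : 'I_r & T i}}) : Defs.pmap h T :=
  @finfun 'I_r (fun i => {ffun 'I_h -> T i}) (fun i => [ffun j => untag_at i (x (i, j))]).
rewrite (@pmean_tagged _ _ _ (@tagged_map h) theta').
- apply: eq_bigr => phi _; congr (_ * _).
  rewrite /map_weight pair_big /=; apply: eq_bigr => p _; by rewrite ffunE.
- by move=> phi; apply/ffunP => i; rewrite ffunE; apply/ffunP => j; rewrite !ffunE untag_at_tagged.
- by move=> phi p; rewrite ffunE.
- by move=> x xt; apply/ffunP => -[i j]; rewrite !ffunE /= tagged_untag_at //; apply: xt (i, j).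
Qed.

End TaggedFamily.

Definition edge_set (r h : nat) (I : {set 'I_r}) (u : {ffun 'I_r -> 'I_h}) :
  {set 'I_r * 'I_h} := [set (i, u i) | i in I].

Lemma edge_setP (r h : nat) (I : {set 'I_r}) (u : {ffun 'I_r -> 'I_h}) p :
  p \in edge_set I u -> p.1 \in I /\ p = (p.1, u p.1).
Proof. by case/imsetP => i iI ->. Qed.

Theorem theorem4p1 (r k h : nat) (b : nat -> nat) (eps : R) :
  (1 <= k)%nat -> (k <= r)%nat -> (1 <= h)%nat ->
  (forall i, (1 <= i <= k)%nat -> (0 < b i)%nat) ->
  0 < eps ->
  exists c : R, 0 < c /\
    forall (T : 'I_r -> finType) (mu : forall i, T i -> R),
      (forall i, is_prob_space (mu i)) ->
      forall G : {set 'I_r} -> vtuple T -> nat,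
        bounded_colored_graph k b G ->
      forall (Fcol : {set 'I_r} -> {ffun 'I_r -> 'I_h} -> nat)
             (inv : {set 'I_r} -> option nat) (iota : {set 'I_r} -> nat -> nat),
        uniform_colored_graph k (b k).-1 Fcol inv ->
        color_ident k b (b k).-1 inv iota ->
        (exists G' : {set 'I_r} -> vtuple T -> nat,
            bounded_colored_graph k b G' /\
            (forall I : {set 'I_r}, #|I| = k -> prob_diff mu G G' I <= eps) /\
            hom_prob k mu Fcol inv iota G' = 0)
        \/ c <= hom_prob k mu Fcol inv iota G.
Proof.
move=> k_gt0 _ h_gt0 b_gt0 eps0.
have bk : (0 < b k)%nat by apply: b_gt0; rewrite k_gt0 leqnn.
set n := #|{ffun 'I_r -> 'I_h}|.
have n0 : 0 < n%:R :> R.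
  by rewrite ltr0n /n; apply/card_gt0P; exists [ffun=> Ordinal h_gt0].
(* An index set [I] carries at most [n] edges of [F], one per [u], and the removed sets add up over
   them. *)
have [c [/andP[c0 _] removal]] :=
  @partite_removal R ('I_r * 'I_h)%type k (eps / n%:R) (divr_gt0 eps0 n0).
exists c; split=> // T mu mup G hG Fcol inv iota hF hiota.
pose vis (I : {set 'I_r}) (u : {ffun 'I_r -> 'I_h}) := (#|I| == k) && (Some (Fcol I u) != inv I).
(* [F] has one color fewer than [G] at size [k], so some color [star I] is never asked for by a
   visible edge. *)
have [star hstar] : exists star : {set 'I_r} -> nat, forall I, (star I < b k)%nat /\
    forall u, vis I u -> iota I (Fcol I u) != star I.
  suff /boolp.choice[s hs] : forall I, exists s, (s < b k)%nat /\
      forall u, vis I u -> iota I (Fcol I u) != s by exists s.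
  move=> I; have [|s [sb hs]] := @unused_color (iota I) (b k).-1 (b k); first by rewrite prednK.
  exists s; split=> // u /andP[/eqP Ik _]; apply/eqP; apply: hs.
  by have [_ [Fl _]] := hF I Ik.
pose E := [set edge_set Iu.1 Iu.2 |
  Iu in [set Iu : {set 'I_r} * {ffun 'I_r -> 'I_h} | vis Iu.1 Iu.2]].
have visE I u : vis I u -> edge_set I u \in E.
  by move=> v; apply/imsetP; exists (I, u); rewrite ?inE.
pose at_ (x : {ffun 'I_r * 'I_h -> {i : 'I_r & T i}}) (u : {ffun 'I_r -> 'I_h}) : vtuple T :=
  @finfun 'I_r (fun i => T i) (fun i => untag_at mup i (x (i, u i))).
(* Several [u] encode the same edge, as values outside [I] are irrelevant; quantifying over all
   encodings avoids a choice. *)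
pose A e x := [forall I : {set 'I_r}, forall u : {ffun 'I_r -> 'I_h},
  (vis I u && (edge_set I u == e)) ==> (G I (at_ x u) == iota I (Fcol I u))].
have atE phi u : at_ (tagged_map phi) u = phimap phi u.
  by apply/ffunP => i; rewrite !ffunE untag_at_tagged.
have hA e : e \in E -> #|e| = k /\ dep_on e (A e).
  move=> /imsetP[[I u]]; rewrite inE /= => /andP[/eqP Ik _] ->; split.
    by rewrite card_imset // => i i' [].
  move=> x y xy; apply: eq_forallb => I'; apply: eq_forallb => u'.
  case: (boolP (vis I' u' && _)) => //= /andP[/andP[/eqP I'k _] /eqP ee].
  congr (_ == _); have [|dp _] := hG I'; first by rewrite I'k k_gt0 leqnn.
  apply: dp => i iI; rewrite !ffunE xy // -ee.
  by apply/imsetP; exists i.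
have Gevent phi : hom_event k Fcol inv iota G phi = [forall e in E, A e (tagged_map phi)].
  apply/forallP/forall_inP => [hev e _|hall I].
    apply/forallP => I; apply/forallP => u; apply/implyP => /andP[/andP[Ik v] _].
    by have := hev I; rewrite Ik /= => /forallP /(_ u); rewrite v atE.
  apply/implyP => Ik; apply/forallP => u; apply/implyP => v.
  have vI : vis I u by rewrite /vis Ik.
  have := hall _ (visE I u vI) => /forallP /(_ I) /forallP /(_ u).
  by rewrite vI eqxx atE.
have := removal _ _ (tagged_family_prob mup (@fst 'I_r 'I_h)) E A hA.
case=> [big|[D [hD kill]]].
  right; apply: le_trans big _; rewrite (pmean_pmap mup) /hom_prob [leRHS]big_mkcond /=.
  apply: ler_sum => phi _; rewrite Gevent.
  by case: ifP => _; rewrite ?mulr1 ?mulr0.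
left.
(* [D (edge_set I u)] reads one vertex per part, so a single tuple [t] repeated on all [h] vertices
   of each part can be tested. *)
pose spread (t : vtuple T) : {ffun 'I_r * 'I_h -> {i : 'I_r & T i}} :=
  [ffun p => Tagged T (t p.1)].
pose del (I : {set 'I_r}) (t : vtuple T) :=
  (#|I| == k) && [exists u, vis I u && D (edge_set I u) (spread t)].
pose G' (I : {set 'I_r}) (t : vtuple T) := if del I t then star I else G I t.
have spread_dep (I : {set 'I_r}) u (t t' : vtuple T) :
    vis I u -> (forall i, i \in I -> t i = t' i) ->
    D (edge_set I u) (spread t) = D (edge_set I u) (spread t').
  move=> v tt; have [Dd _] := hD _ (visE I u v); apply: Dd => p /edge_setP[pI _].
  by rewrite !ffunE tt.
exists G'; split; [|split].
- move=> I Ik; have [dp lt] := hG I Ik; split=> [x y xy|x]; rewrite /G'; last first.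
    case: ifP => // /andP[/eqP -> _]; by have [] := hstar I.
  have -> : del I x = del I y.
    rewrite /del; congr andb; apply: eq_existsb => u; case v: (vis I u) => //=.
    exact: spread_dep.
  by rewrite (dp x y xy).
- move=> I Ik; rewrite /prob_diff.
  have w0 (t : vtuple T) : 0 <= edge_weight mu t.
    by apply: prodr_ge0 => i _; have [m0 _] := mup i.
  apply: (@le_trans _ _ (\sum_(t : vtuple T) \sum_(u | vis I u)
      edge_weight mu t * (D (edge_set I u) (spread t))%:R)).
    rewrite big_mkcond; apply: ler_sum => t _.
    have s0 (P : pred {ffun 'I_r -> 'I_h}) :
        0 <= \sum_(u | P u) edge_weight mu t * (D (edge_set I u) (spread t))%:R.
      by apply: sumr_ge0 => u _; rewrite mulr_ge0.
    rewrite /G' /del; case: ifP => [|_]; last exact: s0.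
    case: ifP => [/andP[_ /existsP[u /andP[v Du]]] _|_]; last by rewrite eqxx.
    by rewrite (bigD1 u) //= Du mulr1 lerDl s0.
  rewrite exchange_big /=.
  apply: (@le_trans _ _ (\sum_(u : {ffun 'I_r -> 'I_h}) eps / n%:R)); last first.
    by rewrite sumr_const -/n -[leLHS]mulr_natr divfK ?gt_eqF.
  rewrite big_mkcond; apply: ler_sum => u _; case: ifP => [v|_]; last first.
    by rewrite divr_ge0 // ltW.
  have [Dd Dm] := hD _ (visE I u v); apply: le_trans Dm.
  pose F (z : {ffun 'I_r -> {i : 'I_r & T i}}) : R :=
    (D (edge_set I u) [ffun p => z p.1])%:R.
  have -> : pmean (tagged_family mu (@fst 'I_r 'I_h)) (fun x => (D (edge_set I u) x)%:R)
     = pmean (tagged_family mu (@fst 'I_r 'I_h)) (fun x => F [ffun i => x (i, u i)]).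
    apply: eq_pmean => // x; congr (nat_of_bool _)%:R; apply: Dd => p /edge_setP[_ pE].
    by rewrite {1}pE !ffunE.
  (* Read along the vertices [(i, u i)], a random map is a random tuple. *)
  rewrite (@pmean_inj _ _ _ _ (fun i => (i, u i))); last 2 first.
  + by move=> i i' [].
  + exact: tagged_family_prob.
  rewrite -/(pmean (tagged_family mu id) F) (pmean_vtuple mup); apply: ler_sum => t _.
  rewrite /F; have -> // : [ffun p => [ffun i => Tagged T (t i)] p.1] = spread t.
  by apply/ffunP => p; rewrite !ffunE.
- rewrite /hom_prob big_pred0 // => phi; apply/negbTE/negP => ev.
  (* A copy of [F] in [G'] never uses the color [star I], so it is a copy in [G] without recolored
     edges, which contradicts [kill]. *)
  have keep (I : {set 'I_r}) u : vis I u -> ~~ del I (phimap phi u) /\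
      G I (phimap phi u) == iota I (Fcol I u).
    move=> v; have /andP[Ik vv] := v; move/forallP: ev => /(_ I).
    rewrite Ik /= => /forallP /(_ u); rewrite vv /= /G'; case: ifP => // _ /eqP es.
    by have [_ /(_ u v)] := hstar I; rewrite es eqxx.
  have [e eE De] : exists2 e, e \in E & D e (tagged_map phi).
    apply: kill; apply/forall_inP; rewrite -Gevent; apply/forallP => I.
    apply/implyP => Ik; apply/forallP => u; apply/implyP => v.
    by have [] := keep I u; rewrite /vis ?Ik.
  case/imsetP: (eE) => -[I u]; rewrite inE /= => v eu.
  have [/negP nd _] := keep I u v; apply: nd; rewrite /del; have /andP[-> _] := v.
  apply/existsP; exists u; rewrite v /= -eu.
  have [Dd _] := hD e eE; rewrite -(Dd (tagged_map phi)) // => p.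
  by rewrite eu => /edge_setP[_ pE]; rewrite {1}pE !ffunE.
Qed.
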